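(* Let $R$ be a commutative ring with identity. Suppose every $R$-module has an almost projective envelope. Then $R$ is a coherent locally Artinian ring. Moreover, suppose $R$ satisfies one of the following conditions: (1) $R$ is a reduced ring; (2) the weak global dimension of $R$ is finite; (3) $R$ is a Noetherian ring; (4) for each maximal ideal $\mathfrak{m}$ of $R$, the localization $R_{\mathfrak{m}}$ is a finitely generated projective $R$-module. Then the converse is also true; that is, if $R$ is a coherent locally Artinian ring (and satisfies one of (1)–(4)), then every $R$-module has an almost projective envelope.
   Context: All rings are commutative with identity and all modules are unitary. An $R$-module $M$ is almost projective if $\mathrm{Ext}^1_R(M,N)=0$ for every maximal ideal $\mathfrak{m}$ of $R$ and every $R_{\mathfrak{m}}$-module $N$ (viewed as an $R$-module). A ring $R$ is locally Artinian if $R_{\mathfrak{m}}$ is an Artinian ring for every maximal ideal $\mathfrak{m}$ of $R$. For a class $\mathscr{P}$ of $R$-modules and an $R$-module $M$, an $R$-homomorphism $f:M\to P$ with $P\in\mathscr{P}$ is a $\mathscr{P}$-preenvelope if for every $P'\in\mathscr{P}$ the natural map $\mathrm{Hom}_R(P,P')\to\mathrm{Hom}_R(M,P')$, $g\mapsto gf$, is surjective. It is a $\mathscr{P}$-envelope if moreover every endomorphism $h$ of $P$ with $f=hf$ is an automorphism. An almost projective envelope is a $\mathscr{P}$-envelope for $\mathscr{P}$ the class of almost projective $R$-modules. *)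

(* Defs.v *)
(* With the classical axioms of mathcomp.classical.boolp every type carries a
   choiceType structure and every predicate is boolean; hence [lmodType R] is an
   arbitrary R-module, [submodClosed M] an arbitrary submodule of M, and
   [submodClosed R^o] an arbitrary ideal of R.  [comPzRingType] is an arbitrary
   commutative ring with identity, the zero ring included. *)
From HB Require Import structures.
From mathcomp Require Import all_boot all_order all_algebra.
From mathcomp Require Import ring.
From mathcomp Require Import boolp classical_sets functions.

Set Implicit Arguments.
Unset Strict Implicit.
Unset Printing Implicit Defensive.

Import GRing.Theory.
Local Open Scope ring_scope.
Local Open Scope quotient_scope.

Definition surj (A B : Type) (f : A -> B) : Prop := forall y, exists x, f x = y.

Section Submodule.
Variables (R : pzRingType) (M : lmodType R) (N : submodClosed M).

Definition submod : Type := {x : M | x \in N}.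
HB.instance Definition _ := SubChoice.on submod.
HB.instance Definition _ := [SubChoice_isSubLmodule of submod by <:].

End Submodule.

Section QuotientModule.
Variables (R : pzRingType) (M : lmodType R) (N : submodClosed M).

(* [submodClosed] does not inherit from [zmodClosed], which the library's
   additive quotient requires. *)
Definition submod_zmod : {pred M} := N.
HB.instance Definition _ := GRing.isZmodClosed.Build M submod_zmod
  (GRing.submod_closedB (submodClosedP N)).

Definition quotmod : Type := Quotient.quot submod_zmod.
HB.instance Definition _ := GRing.Zmodule.on quotmod.

Definition quot_pi (x : M) : quotmod := \pi_(Quotient.quot submod_zmod) x.
Definition quot_repr (x : quotmod) : M := repr (x : Quotient.quot submod_zmod).

Lemma quot_reprK : cancel quot_repr quot_pi.
Proof. by move=> x; exact: reprK. Qed.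

Lemma quot_piP x y : reflect (quot_pi x = quot_pi y) (x - y \in N).
Proof.
have -> : (x - y \in N) = (x - y \in submod_zmod) by [].
by rewrite Quotient.idealrBE; exact: eqP.
Qed.

Lemma quot_piD : {morph quot_pi : x y / x + y}.
Proof. by move=> x y; rewrite /quot_pi raddfD. Qed.

Definition quot_scale (a : R) (x : quotmod) : quotmod :=
  quot_pi (a *: quot_repr x).

Lemma quot_scale_pi a x : quot_scale a (quot_pi x) = quot_pi (a *: x).
Proof.
by apply/quot_piP; rewrite -scalerBr rpredZ //; apply/quot_piP/quot_reprK.
Qed.

Lemma quot_scaleA a b x : quot_scale a (quot_scale b x) = quot_scale (a * b) x.
Proof. by rewrite {2}/quot_scale quot_scale_pi scalerA. Qed.

Lemma quot_scale1 : left_id 1 quot_scale.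
Proof. by move=> x; rewrite /quot_scale scale1r quot_reprK. Qed.

Lemma quot_scaleDr : right_distributive quot_scale +%R.
Proof.
move=> a x y; rewrite -[x]quot_reprK -[y]quot_reprK -quot_piD !quot_scale_pi.
by rewrite scalerDr quot_piD.
Qed.

Lemma quot_scaleDl x : {morph quot_scale^~ x : a b / a + b}.
Proof. by move=> a b; rewrite /quot_scale scalerDl quot_piD. Qed.

HB.instance Definition _ := GRing.Zmodule_isLmodule.Build R quotmod
  quot_scaleA quot_scale1 quot_scaleDr quot_scaleDl.

Lemma quot_pi_is_linear : linear quot_pi.
Proof. by move=> a x y; rewrite quot_piD -quot_scale_pi. Qed.
HB.instance Definition _ := GRing.isLinear.Build R M quotmod _ quot_pi
  quot_pi_is_linear.

Section Lift.
Variables (V : lmodType R) (g : {linear M -> V}).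

Definition quot_lift (gN : forall x, x \in N -> g x = 0) (x : quotmod) : V :=
  g (quot_repr x).

Hypothesis gN : forall x, x \in N -> g x = 0.

Lemma quot_lift_pi x : quot_lift gN (quot_pi x) = g x.
Proof.
apply/eqP; rewrite -subr_eq0 /quot_lift.
rewrite (_ : _ - _ = g (quot_repr (quot_pi x) - x)); last by rewrite raddfB.
by apply/eqP/gN/quot_piP/quot_reprK.
Qed.

Lemma quot_lift_is_linear : linear (quot_lift gN).
Proof.
move=> a x y; rewrite -[x]quot_reprK -[y]quot_reprK -linearP.
by rewrite !quot_lift_pi linearP.
Qed.
HB.instance Definition _ := GRing.isLinear.Build R quotmod V _ (quot_lift gN)
  quot_lift_is_linear.

End Lift.

End QuotientModule.

Section Span.
Variables (R : pzRingType) (M : lmodType R) (S : M -> Prop).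

Definition span : {pred M} := fun v =>
  `[< forall N : submodClosed M, (forall x, S x -> x \in N) -> v \in N >].

Lemma span_closed : submod_closed span.
Proof.
split=> [|a x y /asboolP xS /asboolP yS]; apply/asboolP => N SN.
  exact: rpred0.
by rewrite rpredD ?rpredZ ?xS ?yS.
Qed.
HB.instance Definition _ := GRing.isSubmodClosed.Build R M span span_closed.

Lemma span_sub (N : submodClosed M) :
  (forall x, S x -> x \in N) -> forall x, x \in span -> x \in N.
Proof. by move=> SN x /asboolP; apply. Qed.

Lemma mem_span x : S x -> x \in span.
Proof. by move=> Sx; apply/asboolP => N; apply. Qed.

End Span.

Section Kernel.
Variables (R : pzRingType) (M V : lmodType R) (f : {linear M -> V}).

Definition lin_ker : {pred M} := fun x => f x == 0.

Lemma lin_ker_closed : submod_closed lin_ker.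
Proof.
split=> [|a x y /eqP fx /eqP fy]; apply/eqP; first exact: raddf0.
by rewrite linearP fx fy scaler0 addr0.
Qed.
HB.instance Definition _ :=
  GRing.isSubmodClosed.Build R M lin_ker lin_ker_closed.

End Kernel.

Section FreeModule.
Variables (R : pzRingType) (T : choiceType).

Definition fin_supp : {pred T -> R^o} := fun f =>
  `[< exists s : seq T, forall x, x \notin s -> f x = 0 >].

Lemma fin_supp_closed : submod_closed fin_supp.
Proof.
split=> [|a f g /asboolP[s fs] /asboolP[t gt]]; apply/asboolP.
  by exists [::].
exists (s ++ t) => x; rewrite mem_cat negb_or => /andP[xs xt].
have -> : (a *: f + g) x = a *: f x + g x by [].
by rewrite fs // gt // scaler0 addr0.
Qed.
HB.instance Definition _ :=
  GRing.isSubmodClosed.Build R (T -> R^o) fin_supp fin_supp_closed.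

(* Finitely supported functions T -> R. *)
Definition free_mod := submod fin_supp.
HB.instance Definition _ := GRing.Lmodule.on free_mod.

Lemma free_gen_subproof (x : T) :
  (fun y => if y == x then 1 else 0) \in fin_supp.
Proof.
by apply/asboolP; exists [:: x] => y; rewrite inE => /negPf ->.
Qed.
Definition free_gen (x : T) : free_mod :=
  @exist _ (fun f : T -> R^o => f \in fin_supp) _ (free_gen_subproof x).

Definition free_coef (f : free_mod) (x : T) : R := sval f x.

Definition free_supp (f : free_mod) : seq T :=
  undup (sval (cid (asboolW (svalP f)))).

Lemma free_supp_uniq f : uniq (free_supp f).
Proof. exact: undup_uniq. Qed.

Lemma free_suppP f x : x \notin free_supp f -> free_coef f x = 0.
Proof. by rewrite mem_undup /free_coef; case: cid => s; apply. Qed.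

Lemma free_gen_sum f :
  f = \sum_(x <- free_supp f) free_coef f x *: free_gen x.
Proof.
apply: val_inj; apply/funext => y; rewrite raddf_sum /= fct_sumE /=.
under eq_bigr => x _.
  rewrite (_ : _ y = free_coef f x * (x == y)%:R); last first.
    by rewrite -[LHS]/(_ * (if _ then _ else _)) eq_sym; case: eqP.
  over.
have [yf|yf] := boolP (y \in free_supp f).
  rewrite (bigD1_seq y) ?free_supp_uniq //= eqxx mulr1 big1 ?addr0 // => x.
  by move=> /negPf ->; rewrite mulr0.
rewrite -[LHS]/(free_coef f y) free_suppP // big1_seq // => x /andP[_ xf].
by case: eqP => [xy|]; rewrite ?mulr0 //; rewrite xy (negPf yf) in xf.
Qed.

Section Lift.
Variables (V : lmodType R) (F : T -> V).

Definition free_lift (f : free_mod) : V :=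
  \sum_(x <- free_supp f) free_coef f x *: F x.

Lemma free_liftE f s : uniq s -> (forall x, x \notin s -> free_coef f x = 0) ->
  free_lift f = \sum_(x <- s) free_coef f x *: F x.
Proof.
have H t u : uniq t -> uniq u -> {subset t <= u} ->
    (forall x, x \notin t -> free_coef f x = 0) ->
  \sum_(x <- t) free_coef f x *: F x = \sum_(x <- u) free_coef f x *: F x.
  move=> t_uniq u_uniq tu ft.
  rewrite -[RHS](@big_rmcond _ _ _ _ u [in t]) => [|x /ft->]; last first.
    by rewrite scale0r.
  rewrite -big_filter; apply: perm_big; apply: uniq_perm => //.
    exact: filter_uniq.
  by move=> x; rewrite mem_filter; apply/idP/andP => [xt|[]//]; split=> //; apply: tu.
move=> s_uniq fs; have v_uniq := undup_uniq (free_supp f ++ s).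
rewrite /free_lift (H _ _ (free_supp_uniq f) v_uniq) => [||x /free_suppP //].
  rewrite -(H s) // => x xs; by rewrite mem_undup mem_cat xs orbT.
by move=> x xs; rewrite mem_undup mem_cat xs.
Qed.

Lemma free_lift_is_linear : linear free_lift.
Proof.
move=> a f g; set s := undup (free_supp f ++ free_supp g).
have s_uniq : uniq s := undup_uniq _.
have fs x : x \notin s -> free_coef f x = 0.
  by rewrite mem_undup mem_cat negb_or => /andP[/free_suppP].
have gs x : x \notin s -> free_coef g x = 0.
  by rewrite mem_undup mem_cat negb_or => /andP[_ /free_suppP].
have E x : free_coef (a *: f + g) x = a * free_coef f x + free_coef g x by [].
rewrite !(@free_liftE _ s) // => [|x xs]; last first.
  by rewrite E fs ?gs // mulr0 addr0.
rewrite scaler_sumr -big_split /=; apply: eq_bigr => x _.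
by rewrite scalerA -scalerDl.
Qed.
HB.instance Definition _ := GRing.isLinear.Build R free_mod V _ free_lift
  free_lift_is_linear.

Lemma free_lift_gen x : free_lift (free_gen x) = F x.
Proof.
rewrite (@free_liftE _ [:: x]) // => [|y]; first by rewrite big_seq1 /free_coef /= eqxx scale1r.
by rewrite inE /free_coef /= => /negPf ->.
Qed.

End Lift.

End FreeModule.

Section Tensor.
Variables (R : comPzRingType) (M N : lmodType R).
Local Notation e m n := (free_gen R (m : M, n : N)).

Variant tensor_rel : free_mod R (M * N)%type -> Prop :=
| TensorDl m m' n : tensor_rel (e (m + m') n - e m n - e m' n)
| TensorDr m n n' : tensor_rel (e m (n + n') - e m n - e m n')
| TensorZl a m n : tensor_rel (e (a *: m) n - a *: e m n)
| TensorZr a m n : tensor_rel (e m (a *: n) - a *: e m n).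

Definition tensor := quotmod (span tensor_rel).
HB.instance Definition _ := GRing.Lmodule.on tensor.

Definition tens (m : M) (n : N) : tensor := quot_pi (span tensor_rel) (e m n).

Lemma tensDl m m' n : tens (m + m') n = tens m n + tens m' n.
Proof.
apply/eqP; rewrite -subr_eq0 opprD addrA -!raddfB; apply/eqP.
rewrite -[RHS](raddf0 (quot_pi (span tensor_rel))); apply/quot_piP.
by rewrite subr0; apply/mem_span/TensorDl.
Qed.

Lemma tensDr m n n' : tens m (n + n') = tens m n + tens m n'.
Proof.
apply/eqP; rewrite -subr_eq0 opprD addrA -!raddfB; apply/eqP.
rewrite -[RHS](raddf0 (quot_pi (span tensor_rel))); apply/quot_piP.
by rewrite subr0; apply/mem_span/TensorDr.
Qed.

Lemma tensZl a m n : tens (a *: m) n = a *: tens m n.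
Proof.
apply/eqP; rewrite -subr_eq0 /tens -linearZ -raddfB; apply/eqP.
rewrite -[RHS](raddf0 (quot_pi (span tensor_rel))); apply/quot_piP.
by rewrite subr0; apply/mem_span/TensorZl.
Qed.

Lemma tensZr a m n : tens m (a *: n) = a *: tens m n.
Proof.
apply/eqP; rewrite -subr_eq0 /tens -linearZ -raddfB; apply/eqP.
rewrite -[RHS](raddf0 (quot_pi (span tensor_rel))); apply/quot_piP.
by rewrite subr0; apply/mem_span/TensorZr.
Qed.

Section Lift.
Variables (V : lmodType R) (b : M -> N -> V).
Hypotheses (bDl : forall m m' n, b (m + m') n = b m n + b m' n)
           (bDr : forall m n n', b m (n + n') = b m n + b m n')
           (bZl : forall a m n, b (a *: m) n = a *: b m n)
           (bZr : forall a m n, b m (a *: n) = a *: b m n).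

Definition tensor_pre : {linear free_mod R (M * N)%type -> V} :=
  free_lift (fun mn : M * N => b mn.1 mn.2).

Lemma tensor_pre_rel x : x \in span tensor_rel -> tensor_pre x = 0.
Proof.
move=> xS; apply/eqP; apply: (span_sub (N := lin_ker tensor_pre)) xS => _ [] *.
all: apply/eqP; rewrite !raddfB /= !free_lift_gen /=.
- by rewrite bDl addrAC addrK subrr.
- by rewrite bDr addrAC addrK subrr.
- by rewrite bZl linearZ /= free_lift_gen subrr.
- by rewrite bZr linearZ /= free_lift_gen subrr.
Qed.

Definition tensor_lift : {linear tensor -> V} := quot_lift tensor_pre_rel.

Lemma tensor_liftE m n : tensor_lift (tens m n) = b m n.
Proof. by apply: etrans (quot_lift_pi tensor_pre_rel _) _; exact: free_lift_gen. Qed.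

End Lift.

End Tensor.

Section TensorMap.
Variables (R : comPzRingType) (A B M : lmodType R) (f : {linear A -> B}).

Let b (x : A) (y : M) := tens (f x) y.
Let bDl x x' y : b (x + x') y = b x y + b x' y.
Proof. by rewrite /b raddfD tensDl. Qed.
Let bDr x y y' : b x (y + y') = b x y + b x y'.
Proof. exact: tensDr. Qed.
Let bZl a x y : b (a *: x) y = a *: b x y.
Proof. by rewrite /b linearZ tensZl. Qed.
Let bZr a x y : b x (a *: y) = a *: b x y.
Proof. exact: tensZr. Qed.

(* f (x) id_M *)
Definition tensor_map : {linear tensor A M -> tensor B M} :=
  tensor_lift bDl bDr bZl bZr.

Lemma tensor_mapE x y : tensor_map (tens x y) = tens (f x) y.
Proof. exact: tensor_liftE. Qed.

End TensorMap.

Section Localization.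
Variables (R : comPzRingType) (S : mulrClosed R).

Definition loc_pair : Type := (R * {s : R | s \in S})%type.
HB.instance Definition _ := Choice.on loc_pair.

(* a/s = b/t iff u (a t - b s) = 0 for some u in S. *)
Definition loc_equiv : rel loc_pair := fun x y =>
  `[< exists2 u, u \in S & u * (x.1 * sval y.2 - y.1 * sval x.2) = 0 >].

Lemma loc_equiv_refl : reflexive loc_equiv.
Proof. by move=> x; apply/asboolP; exists 1; rewrite ?rpred1 // subrr mulr0. Qed.

Lemma loc_equiv_sym : symmetric loc_equiv.
Proof.
have H x y : loc_equiv x y -> loc_equiv y x.
  move=> /asboolP[u uS E]; apply/asboolP; exists u => //.
  by rewrite -opprB mulrN E oppr0.
by move=> x y; apply/idP/idP; apply: H.
Qed.

Lemma loc_equiv_trans : transitive loc_equiv.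
Proof.
move=> y x z /asboolP[u uS E] /asboolP[v vS F]; apply/asboolP.
exists (u * v * sval y.2); first by rewrite !rpredM ?(svalP y.2).
rewrite (_ : _ * (_ - _) =
  v * sval z.2 * (u * (x.1 * sval y.2 - y.1 * sval x.2)) +
  u * sval x.2 * (v * (y.1 * sval z.2 - z.1 * sval y.2))); last by ring.
by rewrite E F !mulr0 addr0.
Qed.

Canonical loc_equiv_equiv :=
  EquivRel loc_equiv loc_equiv_refl loc_equiv_sym loc_equiv_trans.

Definition loc : Type := {eq_quot loc_equiv}.
HB.instance Definition _ := Choice.on loc.

Definition loc_one : {s : R | s \in S} := exist _ 1 (rpred1 S).
Definition loc_den (s t : {s : R | s \in S}) : {s : R | s \in S} :=
  exist _ (sval s * sval t) (rpredM (svalP s) (svalP t)).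

Definition loc_frac (a : R) (s : {s : R | s \in S}) : loc :=
  \pi_{eq_quot loc_equiv} ((a, s) : loc_pair).
Definition loc_repr (x : loc) : loc_pair := repr (x : {eq_quot loc_equiv}).

Lemma loc_fracP a s b t :
  loc_frac a s = loc_frac b t <->
  exists2 u, u \in S & u * (a * sval t - b * sval s) = 0.
Proof.
split=> [/eqP|H]; first by rewrite eqmodE => /asboolP.
by apply/eqP; rewrite eqmodE; apply/asboolP.
Qed.

Lemma loc_reprK x : loc_frac (loc_repr x).1 (loc_repr x).2 = x.
Proof.
by rewrite /loc_frac -surjective_pairing; exact: (reprK (x : {eq_quot _})).
Qed.

Lemma loc_fracW (P : loc -> Prop) : (forall a s, P (loc_frac a s)) -> forall x, P x.
Proof. by move=> H x; rewrite -[x]loc_reprK. Qed.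

Definition loc_add (x y : loc) : loc :=
  let: (a, s) := loc_repr x in let: (b, t) := loc_repr y in
  loc_frac (a * sval t + b * sval s) (loc_den s t).
Definition loc_opp (x : loc) : loc :=
  let: (a, s) := loc_repr x in loc_frac (- a) s.
Definition loc_mul (x y : loc) : loc :=
  let: (a, s) := loc_repr x in let: (b, t) := loc_repr y in
  loc_frac (a * b) (loc_den s t).

Lemma loc_addE a s b t :
  loc_add (loc_frac a s) (loc_frac b t) =
  loc_frac (a * sval t + b * sval s) (loc_den s t).
Proof.
rewrite /loc_add; have := loc_reprK (loc_frac a s); have := loc_reprK (loc_frac b t).
case: (loc_repr _) => [b' t'] /= /loc_fracP[v vS F].
case: (loc_repr _) => [a' s'] /= /loc_fracP[u uS E].
apply/loc_fracP; exists (u * v); first by rewrite rpredM.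
rewrite /= (_ : _ * (_ - _) =
  v * sval t * sval t' * (u * (a' * sval s - a * sval s')) +
  u * sval s * sval s' * (v * (b' * sval t - b * sval t'))); last by ring.
by rewrite E F !mulr0 addr0.
Qed.

Lemma loc_oppE a s : loc_opp (loc_frac a s) = loc_frac (- a) s.
Proof.
rewrite /loc_opp; have := loc_reprK (loc_frac a s).
case: (loc_repr _) => [a' s'] /= /loc_fracP[u uS E].
by apply/loc_fracP; exists u; rewrite // !mulNr -opprD mulrN E oppr0.
Qed.

Lemma loc_mulE a s b t :
  loc_mul (loc_frac a s) (loc_frac b t) = loc_frac (a * b) (loc_den s t).
Proof.
rewrite /loc_mul; have := loc_reprK (loc_frac a s); have := loc_reprK (loc_frac b t).
case: (loc_repr _) => [b' t'] /= /loc_fracP[v vS F].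
case: (loc_repr _) => [a' s'] /= /loc_fracP[u uS E].
apply/loc_fracP; exists (u * v); first by rewrite rpredM.
rewrite /= (_ : _ * (_ - _) =
  v * b' * sval t * (u * (a' * sval s - a * sval s')) +
  u * a * sval s' * (v * (b' * sval t - b * sval t'))); last by ring.
by rewrite E F !mulr0 addr0.
Qed.

Lemma loc_frac_eq a s b t : a * sval t = b * sval s -> loc_frac a s = loc_frac b t.
Proof. by move=> E; apply/loc_fracP; exists 1; rewrite ?rpred1 // E subrr mulr0. Qed.

Lemma loc_addA : associative loc_add.
Proof.
elim/loc_fracW=> a s; elim/loc_fracW=> b t; elim/loc_fracW=> c u.
by rewrite !loc_addE; apply: loc_frac_eq => /=; ring.
Qed.

Lemma loc_addC : commutative loc_add.
Proof.
elim/loc_fracW=> a s; elim/loc_fracW=> b t.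
by rewrite !loc_addE; apply: loc_frac_eq => /=; ring.
Qed.

Lemma loc_add0 : left_id (loc_frac 0 loc_one) loc_add.
Proof.
by elim/loc_fracW=> a s; rewrite loc_addE; apply: loc_frac_eq => /=; ring.
Qed.

Lemma loc_addN : left_inverse (loc_frac 0 loc_one) loc_opp loc_add.
Proof.
elim/loc_fracW=> a s.
by rewrite loc_oppE loc_addE; apply: loc_frac_eq => /=; ring.
Qed.

HB.instance Definition _ :=
  GRing.isZmodule.Build loc loc_addA loc_addC loc_add0 loc_addN.

Lemma loc_mulA : associative loc_mul.
Proof.
elim/loc_fracW=> a s; elim/loc_fracW=> b t; elim/loc_fracW=> c u.
by rewrite !loc_mulE; apply: loc_frac_eq => /=; ring.
Qed.

Lemma loc_mulC : commutative loc_mul.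
Proof.
elim/loc_fracW=> a s; elim/loc_fracW=> b t.
by rewrite !loc_mulE; apply: loc_frac_eq => /=; ring.
Qed.

Lemma loc_mul1 : left_id (loc_frac 1 loc_one) loc_mul.
Proof.
by elim/loc_fracW=> a s; rewrite loc_mulE; apply: loc_frac_eq => /=; ring.
Qed.

Lemma loc_mulDl : left_distributive loc_mul loc_add.
Proof.
elim/loc_fracW=> a s; elim/loc_fracW=> b t; elim/loc_fracW=> c u.
by rewrite !(loc_addE, loc_mulE); apply: loc_frac_eq => /=; ring.
Qed.

HB.instance Definition _ :=
  GRing.Zmodule_isComPzRing.Build loc loc_mulA loc_mulC loc_mul1 loc_mulDl.

Definition loc_map (a : R) : loc := loc_frac a loc_one.

Lemma loc_map_is_zmod_morphism : zmod_morphism loc_map.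
Proof.
move=> a b; rewrite -[RHS]/(loc_add (loc_map a) (loc_opp (loc_map b))).
by rewrite loc_oppE loc_addE; apply: loc_frac_eq => /=; ring.
Qed.
HB.instance Definition _ :=
  GRing.isZmodMorphism.Build R loc loc_map loc_map_is_zmod_morphism.

Lemma loc_map_is_monoid_morphism : monoid_morphism loc_map.
Proof.
split=> // a b; rewrite -[RHS]/(loc_mul (loc_map a) (loc_map b)) loc_mulE.
by apply: loc_frac_eq => /=; ring.
Qed.
HB.instance Definition _ :=
  GRing.isMonoidMorphism.Build R loc loc_map loc_map_is_monoid_morphism.

End Localization.

(* Restriction of scalars along phi. *)
Definition restr (R A : pzRingType) (phi : {rmorphism R -> A})
  (N : lmodType A) : Type := N.

Section Restriction.
Variables (R A : pzRingType) (phi : {rmorphism R -> A}) (N : lmodType A).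

HB.instance Definition _ := GRing.Zmodule.on (restr phi N).

Definition restr_scale (a : R) (x : restr phi N) : restr phi N := phi a *: (x : N).

Lemma restr_scaleA a b x :
  restr_scale a (restr_scale b x) = restr_scale (a * b) x.
Proof. by rewrite /restr_scale scalerA rmorphM. Qed.

Lemma restr_scale1 : left_id 1 restr_scale.
Proof. by move=> x; rewrite /restr_scale rmorph1 scale1r. Qed.

Lemma restr_scaleDr : right_distributive restr_scale +%R.
Proof. by move=> a x y; rewrite /restr_scale scalerDr. Qed.

Lemma restr_scaleDl x : {morph restr_scale^~ x : a b / a + b}.
Proof. by move=> a b; rewrite /restr_scale rmorphD scalerDl. Qed.

HB.instance Definition _ := GRing.Zmodule_isLmodule.Build R (restr phi N)
  restr_scaleA restr_scale1 restr_scaleDr restr_scaleDl.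

End Restriction.

Notation ideal R := (submodClosed R^o).

Lemma idealM (R : pzRingType) (I : ideal R) (a x : R) :
  x \in I -> a * x \in I.
Proof. exact: (@rpredZ R R^o I a x). Qed.

Record maxideal (R : pzRingType) := MaxIdeal {
  maxideal_val :> ideal R;
  maxideal_proper : 1 \notin maxideal_val;
  maxideal_max : forall J : ideal R,
    {subset maxideal_val <= J} -> 1 \notin J -> J =i maxideal_val
}.

Section LocalizationAtMaximal.
Variables (R : comPzRingType) (m : maxideal R).

Definition max_compl : {pred R} := fun x => x \notin (m : ideal R).

(* The ideal m + Ra. *)
Definition max_add (a : R) : {pred R^o} :=
  fun x => `[< exists r : R, x - r * a \in (m : ideal R) >].

Lemma max_add_closed a : submod_closed (max_add a).
Proof.
split=> [|c x y /asboolP[r xr] /asboolP[s ys]]; apply/asboolP.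
  by exists 0; rewrite mul0r subr0 rpred0.
exists (c * r + s); rewrite -[c *: x]/(c * x : R).
rewrite (_ : _ - _ = c * (x - r * a) + (y - s * a)); last by ring.
by rewrite rpredD // idealM.
Qed.
HB.instance Definition _ a :=
  GRing.isSubmodClosed.Build R R^o (max_add a) (max_add_closed a).

Lemma max_compl_closed : mulr_closed max_compl.
Proof.
split=> [|a b aNm bNm]; first exact: maxideal_proper.
have max_addS : {subset (m : ideal R) <= max_add a}.
  by move=> x xm; apply/asboolP; exists 0; rewrite mul0r subr0.
have [one_notin|/negPn/asboolP[r mr]] := boolP (1 \notin max_add a).
  have max_addE := @maxideal_max R m (max_add a) max_addS one_notin.
  case/negP: aNm; rewrite -max_addE.
  by apply/asboolP; exists 1; rewrite mul1r subrr rpred0.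
apply/negP => abm; case/negP: bNm.
have -> : b = b * (1 - r * a) + r * (a * b) by ring.
by apply: rpredD; apply: idealM.
Qed.
HB.instance Definition _ := GRing.isMulClosed.Build R max_compl max_compl_closed.

Definition locmax := loc max_compl.
HB.instance Definition _ := GRing.ComPzRing.on locmax.

Definition locmax_map : {rmorphism R -> locmax} := @loc_map R max_compl.

End LocalizationAtMaximal.

Section ModuleProperties.
Variables (R : comPzRingType).

Definition projective (P : lmodType R) : Prop :=
  forall (A B : lmodType R) (g : {linear A -> B}) (f : {linear P -> B}),
    surj g -> exists h : {linear P -> A}, forall x, g (h x) = f x.

Definition flat (M : lmodType R) : Prop :=
  forall (A B : lmodType R) (f : {linear A -> B}),
    injective f -> injective (tensor_map M f).

Definition fin_generated (M : lmodType R) : Prop :=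
  exists (n : nat) (p : {linear 'rV[R]_n -> M}), surj p.

Definition fin_presented (M : lmodType R) : Prop :=
  exists (k n : nat) (q : {linear 'rV[R]_k -> 'rV[R]_n})
         (p : {linear 'rV[R]_n -> M}),
    surj p /\ forall v, p v = 0 <-> exists w, q w = v.

(* ... -> C_1 -> C_0 -> M -> 0 exact, with every C_i in the class C. *)
Record resolution (C : lmodType R -> Prop) (M : lmodType R) := Resolution {
  res_term :> nat -> lmodType R;
  res_termP : forall i, C (res_term i);
  res_diff : forall i, {linear res_term i.+1 -> res_term i};
  res_aug : {linear res_term 0%N -> M};
  res_aug_surj : surj res_aug;
  res_exact0 : forall x, res_aug x = 0 <-> exists y, res_diff 0%N y = x;
  res_exact : forall i x, res_diff i x = 0 <-> exists y, res_diff i.+1 y = x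
}.

Lemma free_projective (T : choiceType) : projective (free_mod R T).
Proof.
move=> A B g f g_surj.
exists (free_lift (fun x : T => sval (cid (g_surj (f (free_gen R x)))))) => y.
rewrite {2}[y]free_gen_sum /free_lift /= !raddf_sum; apply: eq_bigr => x _.
by rewrite /= !linearZ; case: cid => z /= ->.
Qed.

Section FreeResolution.
Variable M : lmodType R.

Definition free_cover (V : lmodType R) : {linear free_mod R V -> V} :=
  free_lift (fun x : V => x).

Lemma free_cover_surj V : surj (free_cover V).
Proof. by move=> x; exists (free_gen R x); exact: free_lift_gen. Qed.

Fixpoint syzygy (i : nat) : lmodType R :=
  if i is j.+1 then submod (lin_ker (free_cover (syzygy j))) else M.

Definition syzygy_incl i :
    {linear syzygy i.+1 -> free_mod R (syzygy i)} :=
  (val : submod (lin_ker (free_cover (syzygy i))) -> _).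

Definition free_diff i :
    {linear free_mod R (syzygy i.+1) -> free_mod R (syzygy i)} :=
  syzygy_incl i \o free_cover (syzygy i.+1).

Lemma free_diff_image i x :
  free_cover (syzygy i) x = 0 <-> exists y, free_diff i y = x.
Proof.
split=> [/eqP x0|[y <-]]; last first.
  by apply/eqP; exact: (valP (free_cover (syzygy i.+1) y)).
have [y yE] := free_cover_surj
  (exist _ x x0 : submod (lin_ker (free_cover (syzygy i)))).
by exists y; rewrite /= -/free_cover; move: yE => /= ->.
Qed.

Lemma free_diff_exact i x :
  free_diff i x = 0 <-> exists y, free_diff i.+1 y = x.
Proof.
rewrite -free_diff_image; split=> [x0|x0]; last by rewrite /= x0.
by apply: val_inj.
Qed.

Definition free_resolution : resolution projective M :=
  @Resolution projective M (fun i => free_mod R (syzygy i))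
    (fun i => @free_projective _) free_diff (free_cover M)
    (@free_cover_surj M) (@free_diff_image 0) free_diff_exact.

End FreeResolution.

(* Ext^1(M, N) is H^1(Hom(P, N)) for any projective resolution P of M; such
   resolutions exist by [free_resolution]. *)
Definition Ext1_eq0 (M N : lmodType R) : Prop :=
  forall (P : resolution projective M) (f : {linear P 1%N -> N}),
    (forall x, f (res_diff P 1 x) = 0) ->
    exists g : {linear P 0%N -> N}, forall x, f x = g (res_diff P 0 x).

Definition almost_projective (M : lmodType R) : Prop :=
  forall (m : maxideal R) (N : lmodType (locmax m)),
    Ext1_eq0 M (restr (locmax_map m) N).

Definition preenvelope (C : lmodType R -> Prop) (M P : lmodType R)
    (f : {linear M -> P}) : Prop :=
  C P /\ forall (P' : lmodType R) (h : {linear M -> P'}), C P' ->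
    exists g : {linear P -> P'}, forall x, g (f x) = h x.

Definition envelope (C : lmodType R -> Prop) (M P : lmodType R)
    (f : {linear M -> P}) : Prop :=
  preenvelope C f /\
  forall h : {linear P -> P}, (forall x, h (f x) = f x) -> bijective h.

Definition has_envelope (C : lmodType R -> Prop) (M : lmodType R) : Prop :=
  exists (P : lmodType R) (f : {linear M -> P}), envelope C f.

Definition flat_dim_le (M : lmodType R) (n : nat) : Prop :=
  exists F : resolution flat M, forall i, (n < i)%N -> forall x : F i, x = 0.

End ModuleProperties.

Section RingProperties.
Variables (R : comPzRingType).

Definition artinian : Prop :=
  forall I : nat -> ideal R, (forall n, {subset I n.+1 <= I n}) ->
    exists n, forall k, (n <= k)%N -> I k =i I n.

Definition noetherian : Prop :=
  forall I : nat -> ideal R, (forall n, {subset I n <= I n.+1}) ->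
    exists n, forall k, (n <= k)%N -> I k =i I n.

Definition coherent : Prop :=
  forall I : ideal R, fin_generated (submod I) -> fin_presented (submod I).

Definition reduced : Prop := forall (x : R) (n : nat), x ^+ n = 0 -> x = 0.

(* The weak global dimension is the supremum of the flat dimensions of all
   modules. *)
Definition fin_weak_gldim : Prop :=
  exists n, forall M : lmodType R, flat_dim_le M n.

End RingProperties.

Definition locally_artinian (R : comPzRingType) : Prop :=
  forall m : maxideal R, artinian (locmax m).

(* Main.v *)
From HB Require Import structures.
From mathcomp Require Import all_boot all_order all_algebra.
From mathcomp Require Import ring.
From mathcomp Require Import boolp classical_sets functions.
Require Import Defs.

Set Implicit Arguments.
Unset Strict Implicit.
Unset Printing Implicit Defensive.

Import GRing.Theory.
Local Open Scope ring_scope.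

(** Write [R_m] for the localization of [R] at a maximal ideal [m].  The
    [R_m]-modules are the [R]-modules on which every element outside [m] acts
    bijectively ([mlocal]), and [M] is almost projective exactly when every map
    out of [M] lifts along every surjection with such a kernel
    ([almost_projective_lift]).  So the class of almost projective modules is
    closed under direct summands, and an almost projective module has, at each
    [m], a dual basis with coordinates in [R_m] ([local_dual_basis]).

    Suppose that every module has an almost projective envelope.  A
    preenvelope of [R^T] splits, because each coordinate of [R^T] factors
    through it; so [R^T] is almost projective ([envelopes_products]).  Local
    dual bases give the equational criterion of flatness for [R^T]
    ([almost_projective_eq_flat]); applied to the tautological relation, where
    [T] is the set of all relations between [a_1, ..., a_n], it says that these
    relations are finitely generated, so [R] is coherent.  Following Chase,
    they also show that [m R_m] is T-nilpotent ([product_t_nilpotent]): if all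
    products [b_n] of a sequence of [m] were nonzero in [R_m], the element
    [\sum_n b_n y_n] of [R^nat], where the sequence [y_n] starts at
    [n] and has a unit coordinate that the earlier ones lack, would have
    infinitely many nonzero coordinates.  T-nilpotence gives [x] in [R] whose annihilator in [R_m] is
    [m R_m]; by coherence the annihilator of [x] is finitely generated, hence
    [m R_m] is finitely generated and nilpotent ([local_structure]) and [R_m]
    is Artinian ([local_artinian]).

    Conversely let [R] be coherent and locally Artinian.  Each [m R_m] is
    T-nilpotent ([artinian_t_nilpotent]), so [local_structure] applies again.

    If [R] is reduced or of finite weak global dimension, then each [R_m] is a
    field.  In the second case the socle element [x] detects [m P] in every
    projective [R_m]-module [P]: it is the kernel of multiplication by [x].
    Therefore injections between projective [R_m]-modules stay injective modulo
    [m] and split; working down a finite flat resolution of [R/m], the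
    localization of [R/m] is projective, which forces [x] to be a unit and
    [m R_m] to vanish.  When all [R_m] are fields every module is almost
    projective, because extensions by [R_m]-vector spaces split
    ([field_kernel_lift]), and identities are envelopes.

    If [R] is Noetherian, or if each [R_m] is finitely generated and projective
    over [R], then some [e] outside [m] annihilates the kernel of [R -> R_m].
    These elements generate the unit ideal; finitely many of them suffice, and
    they show that [R] is semiprimary with finitely generated radical [J]
    ([isolated_semiprimary]) and that almost projective modules are projective
    ([isolated_projective]).  Over such a coherent ring the powers [R^T] are
    projective and every projective module is a direct summand of one.  The
    evaluation map from [M] to [R^Hom(M, R)] is then a projective preenvelope,
    and removing a largest projective direct summand of its cokernel, found
    modulo [J] and lifted as an idempotent, makes it an envelope
    ([projective_envelope]). *)

(** * Identities in modules *)

Section Idealization.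
Variables (R : comPzRingType) (M : lmodType R).

(** The square-zero extension of [R] by [M] is a commutative ring that contains
    [M] additively and [R] as a subring, so that identities between linear
    combinations in [M] are instances of ring identities. *)
Definition idealization : Type := (R * M)%type.
HB.instance Definition _ := GRing.Zmodule.on idealization.

Let mul (x y : idealization) : idealization := (x.1 * y.1, x.1 *: y.2 + y.1 *: x.2).

Lemma idl_mulA : associative mul.
Proof.
move=> x y z; apply: (congr2 pair); first exact: mulrA.
rewrite /= !scalerDr !scalerA addrA.
by rewrite [z.1 * x.1]mulrC [z.1 * y.1]mulrC.
Qed.

Lemma idl_mulC : commutative mul.
Proof. by move=> x y; apply: (congr2 pair); rewrite /= ?[y.1 * _]mulrC // addrC. Qed.

Lemma idl_mul1 : left_id ((1, 0) : idealization) mul.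
Proof.
by case=> a x; apply: (congr2 pair); rewrite /= ?mul1r // scale1r scaler0 addr0.
Qed.

Lemma idl_mulDl : left_distributive mul +%R.
Proof.
move=> x y z; apply: (congr2 pair); first exact: mulrDl.
by rewrite /= scalerDl scalerDr addrACA.
Qed.

HB.instance Definition _ := GRing.Zmodule_isComPzRing.Build idealization
  idl_mulA idl_mulC idl_mul1 idl_mulDl.

Definition idl_scal (a : R) : idealization := (a, 0).
Definition idl_vec (x : M) : idealization := (0, x).

Lemma idl_scal_zmod : zmod_morphism idl_scal.
Proof. by move=> a b; apply: (congr2 pair); rewrite //= subr0. Qed.
HB.instance Definition _ :=
  GRing.isZmodMorphism.Build R idealization idl_scal idl_scal_zmod.

Lemma idl_scal_monoid : monoid_morphism idl_scal.
Proof. by split=> // a b; apply: (congr2 pair); rewrite //= !scaler0 addr0. Qed.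
HB.instance Definition _ :=
  GRing.isMonoidMorphism.Build R idealization idl_scal idl_scal_monoid.

Lemma idl_vec_zmod : zmod_morphism idl_vec.
Proof. by move=> a b; apply: (congr2 pair); rewrite //= subr0. Qed.
HB.instance Definition _ :=
  GRing.isZmodMorphism.Build M idealization idl_vec idl_vec_zmod.

Lemma idl_vecZ a x : idl_vec (a *: x) = idl_scal a * idl_vec x.
Proof. by apply: (congr2 pair); rewrite /= ?mulr0 // scale0r addr0. Qed.

Lemma idl_vec_inj : injective idl_vec.
Proof. by move=> x y []. Qed.

Lemma idl_vecE : ((forall x y, idl_vec (x + y)%R = (idl_vec x + idl_vec y)%R) *
  (forall x y, idl_vec (x - y)%R = (idl_vec x - idl_vec y)%R) *
  (forall x, idl_vec (- x)%R = (- idl_vec x)%R) * (idl_vec 0 = 0%R) *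
  (forall x n, idl_vec (x *+ n)%R = (idl_vec x *+ n)%R) *
  (forall a x, idl_vec (a *: x)%R = (idl_scal a * idl_vec x)%R))%type.
Proof.
do !split=> *; rewrite ?idl_vecZ //;
  [exact: raddfD|exact: raddfB|exact: raddfN|exact: raddfMn].
Qed.

End Idealization.

Ltac module_ring := apply: idl_vec_inj; rewrite ?idl_vecE; ring.

(** * Linear maps and submodules *)

Definition mklin (R : pzRingType) (U V : lmodType R) (f : U -> V)
  (lf : linear f) : {linear U -> V} :=
  HB.pack f (GRing.isLinear.Build R U V *:%R f lf).

Section Basics.
Variable R : comPzRingType.

Lemma mklinE (U V : lmodType R) (f : U -> V) (lf : linear f) x : mklin lf x = f x.
Proof. by []. Qed.

Lemma lin_bij_inv (U V : lmodType R) (f : {linear U -> V}) : bijective f ->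
  exists g : {linear V -> U}, cancel f g /\ cancel g f.
Proof.
case=> g fK gK.
have lg : linear g by move=> a x y; rewrite -[RHS]fK linearP !gK.
by exists (mklin lg).
Qed.

Definition comp_lin (U V W : lmodType R) (g : {linear V -> W}) (f : {linear U -> V})
  : {linear U -> W} := g \o f.

Lemma lin_factor (U V W : lmodType R) (f : {linear U -> V}) (g : {linear U -> W}) :
  surj f -> (forall x, f x = 0 -> g x = 0) ->
  exists h : {linear V -> W}, forall x, h (f x) = g x.
Proof.
move=> fs fg; pose h y := g (sval (cid (fs y))).
have hf x : h (f x) = g x.
  rewrite /h; case: cid => z /= fz; apply/eqP; rewrite -subr_eq0 -linearB.
  by apply/eqP; apply: fg; rewrite linearB fz subrr.
have lh : linear h.
  move=> a u v; have [[x <-] [y <-]] := (fs u, fs v).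
  by rewrite -linearP !hf linearP.
by exists (mklin lh).
Qed.

End Basics.

Section Submodules.
Variables (R : comPzRingType) (M : lmodType R).

Lemma mksub_subproof (S : M -> Prop) : S 0 ->
  (forall a x y, S x -> S y -> S (a *: x + y)) ->
  submod_closed (fun x : M => `[< S x >]).
Proof.
move=> S0 SP; split=> [|a x y /asboolP xS /asboolP yS]; apply/asboolP => //.
exact: SP.
Qed.

Definition mksub (S : M -> Prop) (S0 : S 0)
  (SP : forall a x y, S x -> S y -> S (a *: x + y)) : submodClosed M :=
  HB.pack ((fun x : M => `[< S x >]) : {pred M})
    (GRing.isSubmodClosed.Build R M _ (mksub_subproof S0 SP)).

Lemma mksubP (S : M -> Prop) (S0 : S 0) SP x : x \in mksub S0 SP <-> S x.
Proof. by split=> [/asboolP|?]; last exact/asboolP. Qed.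

Lemma submodB (N : submodClosed M) x y : x \in N -> y \in N -> x - y \in N.
Proof. exact: (GRing.submod_closedB (submodClosedP N)).2. Qed.

Definition lin_im (L : lmodType R) (f : {linear L -> M}) : submodClosed M.
refine (@mksub (fun y => exists x, f x = y) _ _).
- by exists 0; rewrite linear0.
- by move=> a _ _ [x <-] [y <-]; exists (a *: x + y); rewrite linearP.
Defined.

Lemma lin_imP (L : lmodType R) (f : {linear L -> M}) y :
  y \in lin_im f <-> exists x, f x = y.
Proof. exact: mksubP. Qed.

Lemma lin_kerP (V : lmodType R) (f : {linear M -> V}) x :
  x \in lin_ker f <-> f x = 0.
Proof. by split=> [/eqP|/eqP]. Qed.

Definition submk (N : submodClosed M) x (xN : x \in N) : submod N :=
  exist (fun x => x \in N) x xN.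

Definition incl (N : submodClosed M) : {linear submod N -> M} :=
  (val : submod N -> M).

End Submodules.

(** * Semisimple modules *)

Section Semisimple.
Variable R : comPzRingType.

(** The submodule generated by [w] is zero or simple. *)
Definition atom (V : lmodType R) (w : V) : Prop :=
  forall a : R, a *: w = 0 \/ exists b, b *: (a *: w) = w.

(** [V] is spanned by atoms; multiples of atoms are atoms, so plain sums are
    enough. *)
Definition semisimple (V : lmodType R) : Prop :=
  forall v : V, exists (n : nat) (w : 'I_n -> V),
    (forall i, atom (w i)) /\ v = \sum_i w i.

(** By Zorn, take [T] maximal with [T] and [U] meeting in [0]: an atom outside
    [U + T] spans a simple module that meets [U + T] trivially, so it could be
    added to [T]. *)
Lemma semisimple_complement (V : lmodType R) (U : submodClosed V) :
  semisimple V -> exists T : submodClosed V,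
    (forall x, x \in U -> x \in T -> x = 0) /\
    (forall v, exists2 u, u \in U & v - u \in T).
Proof.
move=> ssV.
(* The empty set qualifies, being the union of the empty chain. *)
pose P (A : set V) := (forall a x y, A x -> A y -> A (a *: x + y)) /\
  (forall x, A x -> x \in U -> x = 0).
have [F FP Ftot|A [[AP AU] Amax]] := @Zorn_bigcup V P.
  split=> [a x y [X FX Xx] [Y FY Yy]|x [X FX Xx]]; last first.
    exact: (FP _ FX).2.
  have [XY|YX] := Ftot _ _ FX FY.
    by exists Y => //; apply: (FP _ FY).1 => //; apply: XY.
  by exists X => //; apply: (FP _ FX).1 => //; apply: YX.
have A0 : A 0.
  have [//|nA] := pselect (A 0); exfalso.
  apply: (Amax [set 0 : V]%classic); last first.
    by split=> [a _ _ -> ->|x -> //]; rewrite /= scaler0 addr0.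
  split=> [x Ax|]; last by move/(_ _ erefl).
  by case: nA; rewrite -(subrr x) addrC -scaleN1r; apply: AP.
exists (mksub A0 AP); split=> [x xU /mksubP xA|]; first exact: AU.
pose good v := exists2 u, u \in U & A (v - u).
have goodP a x y : good x -> good y -> good (a *: x + y).
  move=> [u uU Ax] [v vU Ay]; exists (a *: u + v).
    by rewrite rpredD // rpredZ.
  by rewrite opprD addrACA -scalerBr; apply: AP.
have good0 : good 0 by exists 0; rewrite ?rpred0 ?subr0.
have good_atom w : atom w -> good w.
  move=> w_atom; have [//|ngw] := pselect (good w).
  have w_meet a : good (a *: w) -> a *: w = 0.
    move=> gaw; have [//|[b bw]] := w_atom a.
    by case: ngw; rewrite -bw -[_ *: _]addr0; apply: goodP.
  have AA x : A x -> good x by exists 0; rewrite ?rpred0 ?subr0.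
  pose B : set V := [set x | exists a y, A y /\ x = a *: w + y]%classic.
  exfalso; apply: (Amax B).
    split=> [x Ax|BA]; first by exists 0, x; rewrite scale0r add0r.
    by apply/ngw/AA/BA; exists 1, 0; rewrite scale1r addr0.
  split=> [a _ _ [b [y [Ay ->]]] [c [z [Az ->]]]|_ [a [y [Ay ->]]] xU].
    exists (a * b + c), (a *: y + z); split; first exact: AP.
    by rewrite scalerDr scalerDl scalerA addrACA.
  have aw0 : a *: w = 0.
    apply: w_meet; exists (a *: w + y) => //.
    by rewrite opprD addNKr -scaleN1r -[_ *: y]addr0; apply: AP.
  by move: xU; rewrite aw0 add0r => yU; apply: AU.
have goodT v : good v.
  have [n [w [w_atom ->]]] := ssV v.
  elim/big_ind: _ => // [x y gx gy|i _]; last exact: good_atom.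
  by rewrite -[x]scale1r; apply: goodP.
by move=> v; have [u uU Avu] := goodT v; exists u => //; apply/mksubP.
Qed.

Lemma semisimple_proj (V : lmodType R) (U : submodClosed V) :
  semisimple V -> exists p : {linear V -> V},
    (forall v, p v \in U) /\ forall u, u \in U -> p u = u.
Proof.
move=> /(semisimple_complement U)[T [UT VUT]].
pose p v := sval (cid2 (VUT v)).
have pU v : p v \in U by rewrite /p; case: cid2.
have pT v : v - p v \in T by rewrite /p; case: cid2.
have pE u v : u \in U -> v - u \in T -> p v = u.
  move=> uU vT; apply/eqP; rewrite -subr_eq0; apply/eqP/UT.
    exact: submodB.
  have -> : p v - u = (v - u) - (v - p v) by rewrite opprB [RHS]addrC addrA subrK.
  exact: submodB.
have lp : linear p.
  move=> a x y; apply: pE; first by rewrite rpredD ?rpredZ.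
  by rewrite opprD addrACA -scalerBr rpredD ?rpredZ.
exists (mklin lp); split=> // u uU; apply: pE => //.
by rewrite subrr rpred0.
Qed.

(** A von Neumann inverse of [f].  It is a retraction when [f] is injective and
    a section when [f] is surjective. *)
Lemma semisimple_regular (U V : lmodType R) (f : {linear U -> V}) :
  semisimple U -> semisimple V ->
  exists s : {linear V -> U}, forall x, f (s (f x)) = f x.
Proof.
move=> /(semisimple_proj (lin_ker f))[p [pk pid]].
move=> /(semisimple_proj (lin_im f))[q [qi qid]].
have qex v : exists x, f x = q v by apply/lin_imP.
pose s v := let x := sval (cid (qex v)) in x - p x.
have sE x v : f x = q v -> s v = x - p x.
  move=> fx; rewrite /s; case: cid => y /= fy.
  have : p (y - x) = y - x by apply/pid/lin_kerP; rewrite linearB fx fy subrr.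
  rewrite linearB => E; rewrite -[X in X - p y](subrK x) -E.
  by rewrite addrC addrA addKr addrC.
have ls : linear s.
  move=> a u v; have [[x xE] [y yE]] := (qex u, qex v).
  rewrite (sE x u) // (sE y v) // (sE (a *: x + y)).
    by rewrite [p _]linearP opprD addrACA scalerBr.
  by rewrite [LHS]linearP [RHS]linearP xE yE.
exists (mklin ls) => x; rewrite mklinE (sE x) ?qid //; last by apply/lin_imP; exists x.
by rewrite linearB; move/lin_kerP: (pk x) => ->; rewrite subr0.
Qed.

End Semisimple.

(** * Nilpotent finitely generated ideals *)

Section Radical.
Variables (R : comPzRingType) (I : finType) (c : I -> R).

(** Membership in [J V], for [J] the ideal generated by the finite family [c]. *)
Definition inJ (V : lmodType R) (v : V) : Prop :=
  exists w : I -> V, v = \sum_i c i *: w i.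

(** [p J^n = 0].  In particular [kills N 1] says that [J] is nilpotent; varying
    [p] makes the inductions below run on elements, without powers of [J]. *)
Fixpoint kills (n : nat) (p : R) : Prop :=
  if n is k.+1 then forall i, kills k (p * c i) else p = 0.

Lemma inJ0 (V : lmodType R) : inJ (0 : V).
Proof. by exists (fun=> 0); rewrite big1 // => i _; rewrite scaler0. Qed.

Lemma inJP (V : lmodType R) a (x y : V) : inJ x -> inJ y -> inJ (a *: x + y).
Proof.
move=> [u ->] [v ->]; exists (fun i => a *: u i + v i).
rewrite scaler_sumr -big_split; apply: eq_bigr => i _ /=.
by rewrite scalerDr !scalerA mulrC.
Qed.

Definition JV (V : lmodType R) : submodClosed V := mksub (@inJ0 V) (@inJP V).

Lemma JVP (V : lmodType R) (x : V) : x \in JV V <-> inJ x.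
Proof. exact: mksubP. Qed.

Lemma inJB (V : lmodType R) (x y : V) : inJ x -> inJ y -> inJ (x - y).
Proof. by move=> /JVP xJ /JVP yJ; apply/JVP/submodB. Qed.

Lemma inJD (V : lmodType R) (x y : V) : inJ x -> inJ y -> inJ (x + y).
Proof. by move=> xJ yJ; rewrite -[x]scale1r; apply: inJP. Qed.

Lemma inJZ (V : lmodType R) a (x : V) : inJ x -> inJ (a *: x).
Proof. by move=> xJ; rewrite -[_ *: _]addr0; apply: inJP (inJ0 _). Qed.

Lemma inJ_lin (U V : lmodType R) (f : {linear U -> V}) x : inJ x -> inJ (f x).
Proof.
move=> [w ->]; exists (fun i => f (w i)); rewrite linear_sum.
by apply: eq_bigr => i _; rewrite linearZ.
Qed.

Lemma inJ_scale (V : lmodType R) (a : R) (v : V) : inJ (a : R^o) -> inJ (a *: v).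
Proof.
move=> [w ->]; exists (fun i => w i *: v); rewrite scaler_suml.
by apply: eq_bigr => i _; rewrite scalerA.
Qed.

Lemma quotJP (V : lmodType R) (x y : V) :
  quot_pi (JV V) x = quot_pi (JV V) y <-> inJ (x - y).
Proof.
by split=> [/quot_piP/JVP|/JVP xy]; last exact/quot_piP.
Qed.

Lemma quotJ0 (V : lmodType R) (x : V) : quot_pi (JV V) x = 0 <-> inJ x.
Proof. by rewrite -(linear0 (quot_pi (JV V))) quotJP subr0. Qed.

Lemma quot_pi_surj (V : lmodType R) (N : submodClosed V) : surj (quot_pi N).
Proof. by move=> x; exists (quot_repr x); rewrite quot_reprK. Qed.

Lemma quotJ_map (U V : lmodType R) (f : {linear U -> V}) :
  exists g : {linear quotmod (JV U) -> quotmod (JV V)},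
    forall x, g (quot_pi (JV U) x) = quot_pi (JV V) (f x).
Proof.
have [g gE] := lin_factor (g := comp_lin (quot_pi (JV V)) f) (@quot_pi_surj U (JV U))
  (fun x x0 => (quotJ0 (f x)).2 (inJ_lin f ((quotJ0 x).1 x0))).
by exists g.
Qed.

Section Nakayama.
Variable N : nat.
Hypothesis kN : kills N 1.

(** The image of the [N]-th iterate lies in [J^N V]. *)
Lemma nakayama_nil (V : lmodType R) (t : {linear V -> V}) v :
  (forall x, inJ (t x)) -> iter N t v = 0.
Proof.
move=> tJ; rewrite -[LHS]scale1r; move: kN.
elim: (N) (1 : R) v => [p v /= ->|n IHn p v kp]; first by rewrite scale0r.
have tZ k : linear (iter k t) by elim: k => // k IHk a x y /=; rewrite IHk linearP.
rewrite iterSr; have [w ->] := tJ v.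
rewrite -[iter n t]/(mklin (tZ n) : _ -> _) linear_sum scaler_sumr big1 // => i _.
by rewrite linearZ scalerA; apply: IHn.
Qed.

Lemma nakayama_surj (U V : lmodType R) (f : {linear U -> V}) :
  (forall v, exists u, inJ (v - f u)) -> surj f.
Proof.
move=> fJ v; suff: exists u, f u = (1 : R) *: v by rewrite scale1r.
move: kN; elim: (N) (1 : R) v => [p v /= ->|n IHn p v kp].
  by exists 0; rewrite scale0r linear0.
have [u [w vE]] := fJ v.
have [z zE] := boolp.choice (fun i => IHn _ (w i) (kp i)).
exists (p *: u + \sum_i z i); rewrite linearP linear_sum.
rewrite -[v](subrK (f u)) vE scalerDr addrC scaler_sumr; congr (_ + _).
by apply: eq_bigr => i _; rewrite zE scalerA.
Qed.

Lemma nakayama_bij (V : lmodType R) (u : {linear V -> V}) :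
  (forall x, inJ (u x - x)) -> bijective u.
Proof.
move=> uJ; have us : surj u.
  by apply: nakayama_surj => v; exists v; rewrite -opprB -scaleN1r -[_ *: _]addr0;
     apply: inJP (inJ0 _).
have u0 x : u x = 0 -> x = 0.
  move=> ux0; pose t : {linear V -> V} := idfun \- u.
  have tx : t x = x by rewrite /= ux0 subr0.
  rewrite -[LHS](_ : iter N t x = x); last by elim: (N) => //= n ->.
  apply: nakayama_nil => y; rewrite /= -opprB -scaleN1r -[_ *: _]addr0.
  exact: inJP (inJ0 _).
have [g gK] := boolp.choice us.
exists g => // x; apply/eqP; rewrite -subr_eq0; apply/eqP/u0.
by rewrite linearB gK subrr.
Qed.

Section IdempotentLift.
Variable L : lmodType R.

Let defect (q : {linear L -> L}) : {linear L -> L} := (q \o q) \- q.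

(** With [d = q^2 - q] and [q' = 3 q^2 - 2 q^3 = q + (1 - 2 q) d] one has
    [q'^2 - q' = d^2 (4 d - 3)]: the defect of idempotence is squared. *)
Lemma newton_step (q : {linear L -> L}) : exists q' : {linear L -> L},
  [/\ forall x, defect q' x = defect q (defect q (defect q x *+ 4 - x *+ 3)),
      forall x, exists y, q' x - q x = defect q y
    & forall x, q x = 0 -> q' x = 0].
Proof.
pose d := defect q; pose t : {linear L -> L} := idfun \- (q \+ q).
pose q' : {linear L -> L} := q \+ (t \o d).
have qB x y : q (x - y) = q x - q y by exact: linearB.
have qD x y : q (x + y) = q x + q y by exact: linearD.
have dB x y : d (x - y) = d x - d y by exact: linearB.
have dD x y : d (x + y) = d x + d y by exact: linearD.
have tE x : t x = x - (q x + q x) by [].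
have dMn y n : d (y *+ n) = d y *+ n by exact: linearMn.
have dE x : d x = q (q x) - q x by [].
have dq x : d (q x) = q (d x) by rewrite !dE qB.
have tq x : t (q x) = q (t x) by rewrite !tE qB qD.
have td x : t (d x) = d (t x) by rewrite !tE dB dD !dq.
have tD x y : t (x + y) = t x + t y by exact: linearD.
have tt x : t (t x) = x + d x *+ 4.
  by rewrite tE tE dE qB qD; module_ring.
have q'E x : q' x = q x + t (d x) by [].
exists q'; split=> [x|x|x qx0].
- rewrite -/d; have -> : defect q' x = q' (q' x) - q' x by [].
  rewrite !q'E.
  have -> : q (q x + t (d x)) = q (q x) + q (t (d x)) by rewrite qD.
  have -> : t (d (q x + t (d x))) = q (t (d x)) + (d (d x) + d (d (d x)) *+ 4).
    by rewrite dD dq tD tq -td tt.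
  have -> : q (q x) = d x + q x by rewrite dE subrK.
  have := tt (d x); rewrite tE => /eqP; rewrite subr_eq => /eqP tdx.
  move: (q (t (d x))) tdx => y ->.
  by rewrite [d (_ *+ 4 - _)]dB !dMn (dB (_ *+ 4)) !dMn; module_ring.
- by exists (t x); rewrite q'E [LHS]addrC addKr td.
have d0 : d x = 0 by rewrite dE qx0 linear0 subr0.
by rewrite q'E d0 qx0 (linear0 t) addr0.
Qed.

Lemma idempotent_lift (q : {linear L -> L}) :
  (forall x, inJ (q (q x) - q x)) ->
  exists q' : {linear L -> L}, [/\ forall x, q' (q' x) = q' x,
    forall x, inJ (q' x - q x) & forall x, q x = 0 -> q' x = 0].
Proof.
move=> qJ.
have H k : exists q' : {linear L -> L},
    [/\ forall p, kills k p -> forall x, p *: defect q' x = 0,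
        forall x, inJ (defect q' x), forall x, inJ (q' x - q x)
      & forall x, q x = 0 -> q' x = 0].
  elim: k => [|k [q1 [q1k q1J q1q q10]]].
    exists q; split=> // [p /= -> x|x]; first by rewrite scale0r.
    by rewrite subrr; apply: inJ0.
  have [q2 [q2d q2q q20]] := newton_step q1; exists q2; split.
  - move=> p kp x; rewrite q2d; set y := _ - _.
    have [w ->] := q1J y; rewrite linear_sum scaler_sumr big1 // => i _.
    by rewrite linearZ scalerA; apply: q1k.
  - by move=> x; rewrite q2d; apply: q1J.
  - move=> x; rewrite -(subrK (q1 x) (q2 x)) -addrA; apply: inJD => //.
    by have [y ->] := q2q x; apply: q1J.
  by move=> x /q10/q20.
have [q' [q'k _ q'q q'0]] := H N; exists q'; split=> // x.
by apply/eqP; rewrite -subr_eq0 -[_ - _]scale1r; apply/eqP/q'k.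
Qed.

End IdempotentLift.
End Nakayama.
End Radical.

(** * Flatness and coherence in terms of equations *)

Section Flatness.
Variable R : comPzRingType.

(** The equational criterion of flatness. *)
Definition eq_flat (F : lmodType R) : Prop :=
  forall n (a : 'I_n -> R) (u : 'I_n -> F), \sum_i a i *: u i = 0 ->
  exists p (C : 'I_n -> 'I_p -> R) (w : 'I_p -> F),
    (forall i, u i = \sum_j C i j *: w j) /\
    (forall j, \sum_i a i * C i j = 0).

(** Coherence of [R], in terms of the relations between the members of a finite
    family; see [relations_fg_coherent] and [coherent_relations_fg]. *)
Definition relations_fg : Prop :=
  forall n (a : 'I_n -> R), exists p (C : 'I_n -> 'I_p -> R),
    (forall j, \sum_i a i * C i j = 0) /\
    (forall v : 'I_n -> R, \sum_i a i * v i = 0 ->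
       exists z : 'I_p -> R, forall i, v i = \sum_j C i j * z j).

Lemma fun_sumE (X : Type) (J : finType) (f : J -> X -> R^o) x :
  (\sum_j f j) x = \sum_j f j x.
Proof. by rewrite fct_sumE. Qed.

(** A relation in [R^X] is a relation in each coordinate, and the same finitely
    many generating relations [C] serve all coordinates. *)
Lemma product_eq_flat (X : Type) : relations_fg -> eq_flat (X -> R^o).
Proof.
move=> fgR n a u au0; have [p [C [aC Cgen]]] := fgR n a.
have ux x : \sum_i a i * u i x = 0.
  by have := congr1 (fun f => f x) au0; rewrite fun_sumE.
have [z zE] := boolp.choice (fun x => Cgen _ (ux x)).
exists p, C, (fun j x => z x j); split=> // i.
by apply/funext => x; rewrite fun_sumE zE.
Qed.

Lemma projective_retract (P L : lmodType R) (i : {linear P -> L})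
  (p : {linear L -> P}) : cancel i p -> projective L -> projective P.
Proof.
move=> ip Lproj A B g f gs.
have [h hE] := Lproj A B g (comp_lin f p) gs.
by exists (comp_lin h i) => x; rewrite /= hE /= ip.
Qed.

End Flatness.

(** * Semiprimary rings *)

(** [J], generated by [rad_gen], is nilpotent and finitely generated, and [R/J]
    is semisimple: it is generated as an ideal by the classes of [atom_gen],
    each of which is an atom. *)
Record semiprimary (R : comPzRingType) := Semiprimary {
  rad_idx : finType;
  rad_gen : rad_idx -> R;
  rad_exp : nat;
  rad_nil : kills rad_gen rad_exp 1;
  atom_num : nat;
  atom_coef : 'I_atom_num -> R;
  atom_gen : 'I_atom_num -> R;
  atom_sum : \sum_i atom_coef i * atom_gen i = 1;
  atom_field : forall i a, inJ rad_gen (atom_gen i * a : R^o) \/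
    exists b, inJ rad_gen (atom_gen i * (1 - b * a) : R^o)
}.

Section Semiprimary.
Variables (R : comPzRingType) (D : semiprimary R).
Local Notation c := (@rad_gen R D).
Local Notation inJ := (inJ c).
Local Notation "V // 'J'" := (quotmod (JV c V)) (at level 40).
Local Notation pi V := (quot_pi (JV c V)).

Lemma quotJ_semisimple (V : lmodType R) : semisimple (V // J).
Proof.
move=> x; have [v <-] := quot_pi_surj x.
exists (atom_num D), (fun i => pi V ((atom_coef i * atom_gen i) *: v)).
split; last first.
  by rewrite -linear_sum -scaler_suml atom_sum scale1r.
have piZ a u : a *: pi V u = pi V (a *: u) by rewrite linearZ.
move=> i a; rewrite piZ; have [eaJ|[b ebJ]] := atom_field i a; [left|right; exists b].
  apply/quotJ0.
  have -> : a *: ((atom_coef i * atom_gen i) *: v) =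
    (atom_gen i * a) *: (atom_coef i *: v).
    by rewrite !scalerA; congr (_ *: _); ring.
  exact: inJ_scale.
rewrite piZ; apply/quotJP.
have -> : b *: (a *: ((atom_coef i * atom_gen i) *: v)) -
    (atom_coef i * atom_gen i) *: v =
  (atom_gen i * (1 - b * a)) *: (- atom_coef i *: v).
  by rewrite !scalerA -scalerBl; congr (_ *: _); ring.
exact: inJ_scale.
Qed.

(** Modulo [J] the injection [f] has a retraction; it lifts to [h : F -> G]
    because [F] is projective, and [h f], being the identity modulo [J], is
    bijective. *)
Lemma splitJ (G F : lmodType R) (f : {linear G -> F}) : projective F ->
  (forall x, inJ (f x) -> inJ x) ->
  exists g : {linear F -> G}, cancel f g.
Proof.
move=> Fproj fJ; have [fb fbE] := quotJ_map c f.
have [s sE] := semisimple_regular fb (@quotJ_semisimple G) (@quotJ_semisimple F).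
have [h hE] := Fproj _ _ (pi G) (comp_lin s (pi F)) (@quot_pi_surj _ _ _).
have [x|k [kK hfK]] := lin_bij_inv (nakayama_bij (rad_nil D) (u := comp_lin h f) _).
  apply/quotJP; rewrite hE; apply/eqP; rewrite -subr_eq0; apply/eqP.
  have [y yE] := quot_pi_surj (s (pi F (f x)) - pi G x).
  rewrite /= -[LHS]yE; apply/quotJ0/fJ/quotJ0.
  by rewrite -fbE yE linearB -fbE sE subrr.
by exists (comp_lin k h) => x; exact: kK.
Qed.

Lemma inJ_sum (V : lmodType R) (T : Type) (s : seq T) (P : pred T) (f : T -> V) :
  (forall t, P t -> inJ (f t)) -> inJ (\sum_(t <- s | P t) f t).
Proof. by move=> fJ; elim/big_ind: _; [exact: inJ0|exact: inJD|]. Qed.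

(** [J^T] is contained in [J (R^T)] because [J] is finitely generated. *)
Lemma inJ_fun (T : Type) (y : T -> R^o) : (forall t, inJ (y t)) -> inJ y.
Proof.
move=> /boolp.choice[w wE]; exists (fun i t => w t i).
by apply/funext => t; rewrite fun_sumE wE.
Qed.

Lemma inJ_free (T : choiceType) (y : free_mod R T) :
  (forall t, inJ (free_coef y t : R^o)) -> inJ y.
Proof.
move=> yJ; rewrite [y]free_gen_sum; apply: inJ_sum => t _.
exact: inJ_scale.
Qed.

(** Let [g : F -> E] be a surjection from a free module.  A direct summand of
    [F / J F] that maps isomorphically onto [E / J E] lifts to a direct summand
    [eps F] of [F], and [g] is surjective on it.  It is also injective there:
    flatness provides for each [u] in its kernel an endomorphism [th] of [F]
    that fixes [u] and has values in the kernel, hence in [J F], so that [u]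
    lies in every [J^n F]. *)
Theorem eq_flat_projective (E : lmodType R) : eq_flat E -> projective E.
Proof.
move=> Eflat; pose F := free_mod R E.
have [g gs] : exists g : {linear F -> E}, surj g.
  by exists (free_cover E); exact: free_cover_surj.
have Fproj : projective F by exact: free_projective.
have [gb gbE] := quotJ_map c g.
have [s sE] := semisimple_regular gb (@quotJ_semisimple F) (@quotJ_semisimple E).
(* [s gb] is an idempotent of [F / J F] with the same kernel as [gb]. *)
have [q qE] := Fproj _ _ (pi F) (comp_lin (comp_lin s gb) (pi F)) (@quot_pi_surj _ _ _).
have qJ x : inJ (q (q x) - q x) by apply/quotJP; rewrite !qE /= qE /= sE.
have [eps [epsK epsq _]] := idempotent_lift (rad_nil D) qJ.
have pieps x : pi F (eps x) = s (gb (pi F x)).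
  by rewrite -[RHS]qE; apply/quotJP.
have ges : surj (comp_lin g eps).
  apply: (nakayama_surj (rad_nil D)) => v; have [u <-] := gs v; exists u.
  by apply/quotJP; rewrite -!gbE pieps sE.
have kerJ u : eps u = u -> g u = 0 -> inJ u.
  by move=> <- gu0; apply/quotJ0; rewrite -epsK pieps gbE gu0 !linear0.
have ker0 u : eps u = u -> g u = 0 -> u = 0.
  move=> epsu gu0; set t := free_supp u.
  pose a (i : 'I_(size t)) := free_coef u (tnth (in_tuple t) i).
  pose f (i : 'I_(size t)) := eps (free_gen R (tnth (in_tuple t) i)).
  have auE : u = \sum_i a i *: f i.
    rewrite -{1}epsu {1}[u]free_gen_sum linear_sum -/t big_tnth.
    by apply: eq_bigr => i _; rewrite linearZ.
  have [|p [C [w [fw aC]]]] := Eflat _ a (fun i => g (f i)).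
    by rewrite -[RHS]gu0 [in RHS]auE linear_sum; apply: eq_bigr => i _; rewrite linearZ.
  have [z zE] := boolp.choice (fun j => ges (w j)).
  (* [b i] is in the kernel of [g]; as the columns of [C] are relations,
     [u] is still the combination of the [b i] with coefficients [a i]. *)
  pose b i := f i - \sum_j C i j *: eps (z j).
  have bJ i : inJ (b i).
    apply: kerJ; rewrite /b linearB linear_sum.
      by rewrite /f epsK; congr (_ - _); apply: eq_bigr => j _; rewrite linearZ /= epsK.
    by rewrite fw -sumrB big1 // => j _; rewrite linearZ -[w j]zE subrr.
  have [th thE] : exists th : {linear F -> F}, forall x, th (free_gen R x) =
      if insub (index x t) is Some i then b i else 0.
    exists (free_lift (fun x => if insub (index x t) is Some i then b i else 0)).
    exact: free_lift_gen.
  have thJ x : inJ (th x).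
    rewrite [x]free_gen_sum linear_sum; apply: inJ_sum => y _.
    rewrite linearZ /= thE; apply: inJZ.
    by case: insub => [i|]; [exact: bJ|exact: inJ0].
  have thu : th u = u.
    rewrite {1}[u]free_gen_sum linear_sum -/t big_tnth /=.
    have t_uniq : uniq t := free_supp_uniq u.
    transitivity (\sum_i a i *: b i).
      apply: eq_bigr => i _; rewrite linearZ /= thE; congr (_ *: _).
      by rewrite (tnth_nth 0) /= index_uniq // valK.
    under eq_bigr => i _ do rewrite scalerBr scaler_sumr.
    rewrite sumrB -auE exchange_big /= [X in _ - X]big1 ?subr0 // => j _.
    under eq_bigr => i _ do rewrite scalerA.
    by rewrite -scaler_suml aC scale0r.
  rewrite -[LHS](_ : iter (rad_exp D) th u = u); last by elim: (rad_exp D) => //= n ->.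
  exact: (nakayama_nil (rad_nil D)).
have [h hE] := lin_factor (g := eps) ges (fun u gu0 => ker0 (eps u) (epsK u) gu0).
apply: (projective_retract (i := h) (p := g)) => // y.
by have [u <-] := ges y; rewrite hE.
Qed.

End Semiprimary.

(** * Projective envelopes over semiprimary rings *)

Section ProjectiveEnvelopes.
Variables (R : comPzRingType) (D : semiprimary R).
Hypothesis fgR : relations_fg R.
Local Notation c := (@rad_gen R D).
Local Notation inJ := (inJ c).
Local Notation pi V := (quot_pi (JV c V)).

Lemma product_projective (T : Type) : projective (T -> R^o).
Proof. by apply: (eq_flat_projective D); exact: product_eq_flat. Qed.

(** The inclusion of a free module in the corresponding power of [R] stays
    injective modulo [J], so it splits. *)
Lemma projective_product_retract (P : lmodType R) : projective P ->
  exists (T : Type) (j : {linear P -> (T -> R^o)}) (k : {linear (T -> R^o) -> P}),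
    cancel j k.
Proof.
move=> Pproj; pose F := free_mod R P.
have [i iE] := Pproj _ _ _ (idfun : {linear P -> P}) (free_cover_surj (V := P)).
pose f : {linear F -> (P -> R^o)} := (val : submod (@fin_supp R P) -> (P -> R^o)).
have [|y yJ|g fK] := splitJ (D := D) (f := f); first exact: product_projective.
  have coordL x : linear (fun u : P -> R^o => u x) by [].
  by apply: inJ_free => x; exact: (inJ_lin (mklin (coordL x))) yJ.
exists P, (comp_lin f i), (comp_lin (free_cover P) g) => x.
by rewrite /= fK iE.
Qed.

(** Let [L = R^Hom(M, R)] and let [Y] be the set of functionals on [L] that
    vanish on the image of [M].  An endomorphism [q] of [L] that vanishes on
    this image and satisfies [phi (q y - y)] in [J] for all [phi] in [Y] is
    idempotent modulo [J], since its own coordinates are in [Y].  Lift it to an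
    idempotent [q'].  The kernel [P] of [q'] contains the image of [M], and
    every functional on [P] that vanishes on this image has values in [J]; so an
    endomorphism of [P] that fixes the image is the identity modulo [J].  To
    find [q], take a von Neumann inverse, modulo [J], of the evaluation map
    from [L] to [R^Y], and lift it to [R^Y], which is projective. *)
Lemma projective_envelope (M : lmodType R) : has_envelope (@projective R) M.
Proof.
pose L := ({linear M -> R^o} -> R^o) : lmodType R.
have evL : linear (fun (x : M) (phi : {linear M -> R^o}) => phi x).
  by move=> a x y; apply/funext => phi; rewrite linearP.
have [ev evE] : exists ev : {linear M -> L}, forall x phi, ev x phi = phi x.
  by exists (mklin evL).
pose Y := {phi : {linear L -> R^o} | forall x, phi (ev x) = 0}.
have psiL : linear (fun (y : L) (phi : Y) => sval phi y).
  by move=> a x y; apply/funext => phi; rewrite linearP.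
have [psi psiE] : exists psi : {linear L -> (Y -> R^o)},
  forall y phi, psi y phi = sval phi y by exists (mklin psiL).
have psi_ev x : psi (ev x) = 0 by apply/funext => -[phi phi0]; rewrite psiE phi0.
have Lproj : projective L by exact: product_projective.
have [psib psibE] := quotJ_map c psi.
have [s sE] := semisimple_regular psib (@quotJ_semisimple R D L)
  (@quotJ_semisimple R D (Y -> R^o)).
(* [g] is such that [psi g psi] and [psi] agree modulo [J]. *)
have [g gE] := @product_projective Y _ _ (pi L) (comp_lin s (pi (Y -> R^o)))
  (@quot_pi_surj _ _ _).
pose q := comp_lin g psi.
have psiq y : inJ (psi (q y) - psi y).
  by apply/quotJP; rewrite -psibE gE /= -psibE sE.
have YJ (phi : {linear L -> R^o}) y : (forall x, phi (ev x) = 0) -> inJ (phi (q y - y)).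
  move=> phi0; have [w wE] := psiq y.
  exists (fun i => w i (exist _ phi phi0)).
  have := congr1 (fun f => f (exist _ phi phi0)) wE.
  by rewrite fun_sumE linearB => <-; rewrite -[RHS]/(psi (q y) _ - psi y _) !psiE.
have coordP (t : {linear M -> R^o}) : linear (fun y : L => y t : R^o) by [].
have LJ (h : {linear L -> L}) y : (forall x, h (ev x) = 0) -> inJ (h (q y - y)).
  move=> h0; apply: inJ_fun => t.
  by apply: (YJ (comp_lin (mklin (coordP t)) h)) => x; rewrite /= h0.
have qev x : q (ev x) = 0 by rewrite -[LHS]/(g (psi (ev x))) psi_ev linear0.
have qJ y : inJ (q (q y) - q y) by rewrite -linearB; apply: LJ.
have [q' [q'K q'q q'0]] := idempotent_lift (rad_nil D) qJ.
have LJ' (h : {linear L -> L}) y : (forall x, h (ev x) = 0) -> q' y = 0 -> inJ (h y).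
  move=> h0 q'y0; have := LJ h y h0; rewrite linearB => hqJ.
  have := inJ_lin h (q'q y); rewrite q'y0 sub0r linearN => hqJ'.
  have -> : h y = - (h (q y) - h y) - (- h (q y)) by rewrite opprB opprK subrK.
  by rewrite -scaleN1r; apply: inJB => //; apply: inJZ.
pose P := submod (lin_ker q').
have pP y : y - q' y \in lin_ker q' by apply/lin_kerP; rewrite linearB q'K subrr.
pose p0 (y : L) : P := exist _ (y - q' y) (pP y).
have p0L : linear p0.
  move=> a x y; apply: val_inj.
  by rewrite /= linearP opprD addrACA -scalerBr.
pose p : {linear L -> P} := mklin p0L.
pose i : {linear P -> L} := (val : submod (lin_ker q') -> L).
have q'i y : q' (i y) = 0 by apply/lin_kerP; exact: (valP y).
have iK : cancel i p by move=> y; apply: val_inj; rewrite /= q'i subr0.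
have pi_ev x : i (p (ev x)) = ev x by rewrite /= q'0 ?subr0 // qev.
exists P, (comp_lin p ev); split; first split.
- exact: projective_retract iK Lproj.
- move=> P' h P'proj; have [T [j [k jK]]] := projective_product_retract P'proj.
  have jL t : linear (fun x : M => j (h x) t : R^o).
    by move=> a x y; rewrite !linearP.
  have kapL : linear (fun (y : L) (t : T) => y (mklin (jL t)) : R^o) by [].
  exists (comp_lin k (comp_lin (mklin kapL) i)) => x.
  by rewrite /= -[RHS]jK; congr (k _); apply/funext => t; rewrite q'0 ?subr0 ?qev.
move=> h hE; apply: (nakayama_bij (rad_nil D)) => y.
pose H : {linear L -> L} := i \o ((h \- idfun) \o p).
have HJ : inJ (H (i y)).
  apply: LJ' => // x; rewrite /H /=.
  by have := hE x; rewrite /= => ->; rewrite subrr.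
rewrite /H /= in HJ.
have := inJ_lin p HJ.
by rewrite [p _](iK (h (p (i y)) - p (i y))) iK.
Qed.

End ProjectiveEnvelopes.

(** * Almost projectivity as a lifting property *)

Section AlmostProjective.
Variable R : comPzRingType.

Lemma lin_corestr (U N E : lmodType R) (i : {linear N -> E}) (f : {linear U -> E}) :
  (forall x, i x = 0 -> x = 0) -> (forall u, exists n, i n = f u) ->
  exists g : {linear U -> N}, forall u, i (g u) = f u.
Proof.
move=> i0 /boolp.choice[g gE].
have lg : linear g.
  move=> a x y; apply/eqP; rewrite -subr_eq0; apply/eqP/i0.
  by rewrite linearB linearP !gE linearP subrr.
by exists (mklin lg).
Qed.

(** The structure of an [R_m]-module, as a property of an [R]-module. *)
Definition mlocal (m : maxideal R) (N : lmodType R) : Prop :=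
  forall s, s \notin (m : ideal R) ->
    (forall x : N, s *: x = 0 -> x = 0) /\ (forall y : N, exists x, s *: x = y).

Section Fractions.
Variables (m : maxideal R).

(** The proof is a parameter of this alias of [N] because the [R_m]-module
    structure attached to it depends on the proof. *)
Definition mlocal_mod (N : lmodType R) of mlocal m N : Type := N.

Lemma loc_map_unit (s : {s : R | s \in max_compl m}) :
  locmax_map m (sval s) * loc_frac 1 s = 1.
Proof.
rewrite -[LHS]/(loc_mul _ _) loc_mulE.
by apply: loc_frac_eq => /=; rewrite !mulr1 !mul1r.
Qed.

Lemma loc_fracE a (s : {s : R | s \in max_compl m}) :
  loc_frac a s = locmax_map m a * loc_frac 1 s :> locmax m.
Proof.
rewrite -[RHS]/(loc_mul _ _) loc_mulE.
by apply: loc_frac_eq => /=; rewrite !mulr1 !mul1r.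
Qed.

Lemma restr_mlocal (N : lmodType (locmax m)) : mlocal m (restr (locmax_map m) N).
Proof.
move=> s sm; pose s' : {s : R | s \in max_compl m} := exist _ s sm.
split=> [x|y].
  rewrite -[_ *: x]/(locmax_map m s *: (x : N)) => sx.
  have : (loc_frac 1 s' : locmax m) *: (locmax_map m (sval s') *: (x : N)) = 0.
    by rewrite sx scaler0.
  by rewrite scalerA mulrC loc_map_unit scale1r.
exists (loc_frac 1 s' *: (y : N)).
rewrite -[LHS]/(locmax_map m s *: (loc_frac 1 s' *: (y : N))) scalerA.
by rewrite (loc_map_unit s') scale1r.
Qed.

Variables (N : lmodType R) (locN : mlocal m N).

Lemma mlocal_inv (s : {s : R | s \in max_compl m}) :
  exists g : {linear N -> N}, forall x, sval s *: g x = x.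
Proof.
have [s0 sS] := locN (svalP s).
exact: (@lin_corestr N N N ( *:%R (sval s)) idfun).
Qed.

Let inv s := sval (cid (mlocal_inv s)).
Let invE s x : sval s *: inv s x = x.
Proof. by rewrite /inv; case: cid. Qed.
Let invP s x y : sval s *: x = y -> inv s y = x.
Proof.
move=> sx; apply/eqP; rewrite -subr_eq0; apply/eqP/(locN (svalP s)).1.
by rewrite scalerBr invE sx subrr.
Qed.

Local Notation Nm := (mlocal_mod locN).
HB.instance Definition _ := GRing.Zmodule.on Nm.

Definition mlocal_scale (f : locmax m) (x : Nm) : Nm :=
  inv (loc_repr f).2 ((loc_repr f).1 *: (x : N)).

Lemma mlocal_scaleE a s (x : N) : mlocal_scale (loc_frac a s) x = inv s (a *: x).
Proof.
rewrite /mlocal_scale; apply: invP.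
have /loc_fracP[u um E] := loc_reprK (loc_frac a s : locmax m).
set f := loc_repr _ in E *; apply/eqP; rewrite -subr_eq0; apply/eqP.
apply: (locN um).1; apply: (locN (svalP s)).1.
have -> : sval s *: (u *: (sval f.2 *: inv s (a *: x) - f.1 *: x)) =
    (u * sval f.2) *: (sval s *: inv s (a *: x)) - (sval s * u * f.1) *: x.
  by rewrite !scalerBr !scalerA; congr (_ *: _ - _ *: _); ring.
rewrite invE scalerA -scalerBl (_ : _ - _ = - (u * (f.1 * sval s - a * sval f.2))).
  by rewrite E oppr0 scale0r.
by ring.
Qed.

Lemma mlocal_scaleP a s (x y : N) :
  sval s *: y = a *: x <-> mlocal_scale (loc_frac a s) x = y.
Proof. by rewrite mlocal_scaleE; split=> [/invP|<-]. Qed.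

Lemma mlocal_scaleA f g x :
  mlocal_scale f (mlocal_scale g x) = mlocal_scale (f * g) x.
Proof.
elim/loc_fracW: f => a s; elim/loc_fracW: g => b t.
rewrite -[_ * _]/(loc_mul _ _) loc_mulE; apply/esym/mlocal_scaleP => /=.
rewrite !mlocal_scaleE (mulrC (sval s)) -scalerA invE scalerA mulrC -scalerA invE.
by rewrite scalerA.
Qed.

Lemma mlocal_scale1 : left_id 1 mlocal_scale.
Proof. by move=> x; apply/mlocal_scaleP. Qed.

Lemma mlocal_scaleDr : right_distributive mlocal_scale +%R.
Proof.
elim/loc_fracW=> a s x y; apply/mlocal_scaleP.
by rewrite !mlocal_scaleE !scalerDr !invE.
Qed.

Lemma mlocal_scaleDl x : {morph mlocal_scale^~ x : a b / a + b}.
Proof.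
elim/loc_fracW=> a s; elim/loc_fracW=> b t.
rewrite -[_ + _]/(loc_add _ _) loc_addE; apply/mlocal_scaleP => /=.
rewrite !mlocal_scaleE scalerDr [X in X *: _ + _]mulrC -!scalerA !invE.
by rewrite scalerDl !scalerA mulrC [X in _ + X *: _]mulrC.
Qed.

HB.instance Definition _ := GRing.Zmodule_isLmodule.Build (locmax m) Nm
  mlocal_scaleA mlocal_scale1 mlocal_scaleDr mlocal_scaleDl.

Lemma mlocal_restrE a (x : N) :
  (a *: (x : restr (locmax_map m) Nm) : N) = a *: x.
Proof. by apply/(mlocal_scaleP a (loc_one (max_compl m))); rewrite scale1r. Qed.

Lemma mlocal_restr_linear : linear (fun x : N => x : restr (locmax_map m) Nm).
Proof. by move=> a x y; congr (_ + _); rewrite [RHS]mlocal_restrE. Qed.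

End Fractions.

(** Every [R_m]-module is [mlocal], and every [mlocal] module comes from an
    [R_m]-module with the same elements. *)
Lemma almost_projective_Ext (M : lmodType R) : almost_projective M <->
  forall (m : maxideal R) (N : lmodType R), mlocal m N -> Ext1_eq0 M N.
Proof.
split=> [APM m N locN P f fd|ExtM m N]; last exact/ExtM/restr_mlocal.
pose i := mklin (mlocal_restr_linear locN).
have [x|g gE] := APM m (mlocal_mod locN) P (comp_lin i f); first by rewrite /= fd.
have lg : linear (g : _ -> N).
  move=> a x y; rewrite linearP; congr (_ + _).
  exact: (mlocal_restrE locN).
exists (mklin lg) => x; exact: gE.
Qed.

(** [Ext^1(M, N) = 0] for the [R_m]-modules [N], in terms of extensions. *)
Definition kernel_lift (m : maxideal R) (M : lmodType R) : Prop :=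
  forall (A B : lmodType R) (g : {linear A -> B}) (f : {linear M -> B}),
    surj g -> mlocal m (submod (lin_ker g)) ->
    exists h : {linear M -> A}, forall x, g (h x) = f x.

(** From left to right, a lift [h0] on the first term of a resolution is
    corrected by a cochain with values in the kernel.  From right to left, a
    cocycle [f] defines an extension of [M] by [N], the pushout of the
    resolution along [f], and a splitting of it gives the cochain. *)
Lemma almost_projective_lift (M : lmodType R) :
  almost_projective M <-> forall m, kernel_lift m M.
Proof.
rewrite almost_projective_Ext; split=> [ExtM m A B g f gs lock|liftM m N locN P f fd].
  have P : resolution (@projective R) M := free_resolution M.
  have [h0 h0E] := res_termP P 0%N _ _ g (comp_lin f (res_aug P)) gs.
  have h0d x : h0 (res_diff P 0 x) \in lin_ker g.
    apply/lin_kerP; rewrite h0E /=.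
    by rewrite (res_exact0 (res_diff P 0 x)).2 ?linear0 //; exists x.
  pose i := incl (lin_ker g).
  have [|u|phi phiE] := @lin_corestr _ _ _ i (comp_lin h0 (res_diff P 0)).
  - by move=> x x0; apply: val_inj.
  - by exists (submk (h0d u)).
  have [x|k kE] := ExtM m _ lock P phi.
    apply: val_inj; rewrite [LHS]phiE /=.
    by rewrite (res_exact (res_diff P 1 x)).2 ?linear0 //; exists x.
  have [x x0|h hE] := lin_factor (g := h0 \- comp_lin i k) (res_aug_surj P).
    have [y <-] := (res_exact0 x).1 x0.
    by rewrite /= -kE [val _]phiE subrr.
  exists h => x; have [y <-] := res_aug_surj P x.
  rewrite hE /= linearB h0E /=.
  have /lin_kerP -> : val (k y) \in lin_ker g by exact: valP.
  by rewrite subr0.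
(* The extension is the pushout of [P 0] and [N] along [P 1]. *)
have dnL : linear (fun x => (res_diff P 0 x, - f x) : (P 0%N * N)%type).
  move=> a x y; apply: congr2; first exact: linearP.
  by rewrite linearP opprD /= scalerN.
pose D := lin_im (mklin dnL); pose E := quotmod D.
have aug_dn z : z \in D -> (res_aug P \o fst) z = 0.
  by move=> /lin_imP[x <-]; apply/res_exact0; exists x.
pose g : {linear E -> M} := quot_lift aug_dn.
have gE p n : g (quot_pi D (p, n)) = res_aug P p by apply: quot_lift_pi.
have jL : linear (fun n : N => quot_pi D (0, n)).
  move=> a x y; rewrite -linearP; congr (quot_pi D _).
  by apply: congr2; rewrite //= scaler0 addr0.
pose j : {linear N -> E} := mklin jL.
have j0 n : j n = 0 -> n = 0.
  rewrite -(linear0 (quot_pi D)) => /quot_piP; rewrite subr0 => /lin_imP[x []].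
  move=> /res_exact[y <-]; rewrite fd oppr0 => //.
have jker z : g z = 0 <-> exists n, j n = z.
  split=> [|[n <-]]; last by rewrite gE linear0.
  have [[p n] <-] := quot_pi_surj z; rewrite gE => /res_exact0[x <-].
  exists (n + f x); apply/quot_piP/lin_imP; exists (- x).
  by rewrite /= !linearN; congr (_, _); rewrite ?sub0r // opprK addrC addKr.
have lock : mlocal m (submod (lin_ker g)).
  move=> s sm; have [s0 sS] := locN s sm; split=> [x sx|y].
    have [n nx] : exists n, j n = val x by apply/jker/lin_kerP/valP.
    have n0 : n = 0 by apply/s0/j0; rewrite linearZ_LR nx -[LHS]/(val (s *: x)) sx.
    by apply: val_inj; rewrite -nx n0 linear0.
  have [n ny] : exists n, j n = val y by apply/jker/lin_kerP/valP.
  have [k kn] := sS n; have kg : j k \in lin_ker g by apply/lin_kerP/jker; exists k.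
  by exists (submk kg); apply: val_inj; rewrite -ny -kn [RHS]linearZ_LR.
have gs : surj g.
  by move=> x; have [p <-] := res_aug_surj P x; exists (quot_pi D (p, 0)); exact: gE.
have [h hE] := liftM m E M g idfun gs lock.
have pL : linear (fun p : P 0%N => quot_pi D (p, 0)).
  move=> a x y; rewrite -linearP; congr (quot_pi D _).
  by apply: congr2; rewrite //= scaler0 addr0.
have [u|nu nuE] := lin_corestr (f := mklin pL \- comp_lin h (res_aug P)) j0.
  by apply/jker; rewrite linearB [g (mklin pL u)]gE hE subrr.
exists nu => x; apply/eqP; rewrite -subr_eq0; apply/eqP/j0.
rewrite linearB nuE /= (res_exact0 (res_diff P 0 x)).2; last by exists x.
rewrite linear0 subr0; apply/eqP; rewrite subr_eq0; apply/eqP/quot_piP/lin_imP.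
exists (- x); rewrite /= !linearN opprK; congr (_, _); rewrite ?sub0r // subr0 //.
Qed.

End AlmostProjective.

(** * Localization of modules *)

Section ModuleLocalization.
Local Open Scope quotient_scope.
Variables (R : comPzRingType) (S : mulrClosed R) (M : lmodType R).

Definition locm_pair : Type := (M * {s : R | s \in S})%type.
HB.instance Definition _ := Choice.on locm_pair.

Definition locm_equiv : rel locm_pair := fun x y =>
  `[< exists2 u, u \in S & u *: (sval y.2 *: x.1 - sval x.2 *: y.1) = 0 >].

Lemma locm_equiv_refl : reflexive locm_equiv.
Proof. by move=> x; apply/asboolP; exists 1; rewrite ?rpred1 // subrr scaler0. Qed.

Lemma locm_equiv_sym : symmetric locm_equiv.
Proof.
have H x y : locm_equiv x y -> locm_equiv y x.
  move=> /asboolP[u uS E]; apply/asboolP; exists u => //.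
  by rewrite -opprB scalerN E oppr0.
by move=> x y; apply/idP/idP; apply: H.
Qed.

Lemma locm_equiv_trans : transitive locm_equiv.
Proof.
move=> y x z /asboolP[u uS E] /asboolP[v vS F]; apply/asboolP.
exists (u * v * sval y.2); first by rewrite !rpredM ?(svalP y.2).
have -> : (u * v * sval y.2) *: (sval z.2 *: x.1 - sval x.2 *: z.1) =
    (v * sval z.2) *: (u *: (sval y.2 *: x.1 - sval x.2 *: y.1)) +
    (u * sval x.2) *: (v *: (sval z.2 *: y.1 - sval y.2 *: z.1)).
  by module_ring.
by rewrite E F !scaler0 addr0.
Qed.

Canonical locm_equiv_equiv :=
  EquivRel locm_equiv locm_equiv_refl locm_equiv_sym locm_equiv_trans.

(** The localization [S^-1 M], by fractions, so that the elements that vanish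
    in it are explicit ([locm_frac0]). *)
Definition locm : Type := {eq_quot locm_equiv}.
HB.instance Definition _ := Choice.on locm.

Definition locm_frac (x : M) (s : {s : R | s \in S}) : locm :=
  \pi_{eq_quot locm_equiv} ((x, s) : locm_pair).
Definition locm_repr (x : locm) : locm_pair := repr (x : {eq_quot locm_equiv}).

Lemma locm_fracP x s y t : locm_frac x s = locm_frac y t <->
  exists2 u, u \in S & u *: (sval t *: x - sval s *: y) = 0.
Proof.
split=> [/eqP|H]; first by rewrite eqmodE => /asboolP.
by apply/eqP; rewrite eqmodE; apply/asboolP.
Qed.

Lemma locm_reprK x : locm_frac (locm_repr x).1 (locm_repr x).2 = x.
Proof.
by rewrite /locm_frac -surjective_pairing; exact: (reprK (x : {eq_quot _})).
Qed.

Lemma locm_fracW (P : locm -> Prop) :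
  (forall x s, P (locm_frac x s)) -> forall z, P z.
Proof. by move=> H z; rewrite -[z]locm_reprK. Qed.

Lemma locm_frac_eq x s y t :
  sval t *: x = sval s *: y -> locm_frac x s = locm_frac y t.
Proof.
by move=> E; apply/locm_fracP; exists 1; rewrite ?rpred1 // E subrr scaler0.
Qed.

Definition locm_add (x y : locm) : locm :=
  let: (a, s) := locm_repr x in let: (b, t) := locm_repr y in
  locm_frac (sval t *: a + sval s *: b) (loc_den s t).
Definition locm_opp (x : locm) : locm :=
  let: (a, s) := locm_repr x in locm_frac (- a) s.
Definition locm_scale (f : loc S) (x : locm) : locm :=
  let: (a, s) := loc_repr f in let: (b, t) := locm_repr x in
  locm_frac (a *: b) (loc_den s t).

Lemma locm_addE x s y t : locm_add (locm_frac x s) (locm_frac y t) =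
  locm_frac (sval t *: x + sval s *: y) (loc_den s t).
Proof.
rewrite /locm_add; have := locm_reprK (locm_frac x s);
  have := locm_reprK (locm_frac y t).
case: (locm_repr _) => [y' t'] /= /locm_fracP[v vS F].
case: (locm_repr _) => [x' s'] /= /locm_fracP[u uS E].
apply/locm_fracP; exists (u * v); first by rewrite rpredM.
rewrite /= (_ : _ *: (_ - _) =
  (v * sval t * sval t') *: (u *: (sval s *: x' - sval s' *: x)) +
  (u * sval s * sval s') *: (v *: (sval t *: y' - sval t' *: y))); last by module_ring.
by rewrite E F !scaler0 addr0.
Qed.

Lemma locm_oppE x s : locm_opp (locm_frac x s) = locm_frac (- x) s.
Proof.
rewrite /locm_opp; have := locm_reprK (locm_frac x s).
case: (locm_repr _) => [x' s'] /= /locm_fracP[u uS E].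
apply/locm_fracP; exists u => //.
by rewrite !scalerN -opprD scalerN E oppr0.
Qed.

Lemma locm_scaleE a s x t :
  locm_scale (loc_frac a s) (locm_frac x t) = locm_frac (a *: x) (loc_den s t).
Proof.
rewrite /locm_scale; have := loc_reprK (loc_frac a s);
  have := locm_reprK (locm_frac x t).
case: (loc_repr _) => [a' s'] /=; case: (locm_repr _) => [x' t'] /=.
move=> /locm_fracP[v vS F] /loc_fracP[u uS E].
apply/locm_fracP; exists (u * v); first by rewrite rpredM.
rewrite /= (_ : _ *: (_ - _) =
  (u * a' * sval s) *: (v *: (sval t *: x' - sval t' *: x)) +
  (v * sval t') *: ((u * (a' * sval s - a * sval s')) *: x)); last by module_ring.
by rewrite E F scale0r !scaler0 addr0.
Qed.

Lemma locm_addA : associative locm_add.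
Proof.
elim/locm_fracW=> a s; elim/locm_fracW=> b t; elim/locm_fracW=> c u.
by rewrite !locm_addE; apply: locm_frac_eq => /=; module_ring.
Qed.

Lemma locm_addC : commutative locm_add.
Proof.
elim/locm_fracW=> a s; elim/locm_fracW=> b t.
by rewrite !locm_addE; apply: locm_frac_eq => /=; module_ring.
Qed.

Lemma locm_add0 : left_id (locm_frac 0 (loc_one S)) locm_add.
Proof.
by elim/locm_fracW=> a s; rewrite locm_addE; apply: locm_frac_eq => /=; module_ring.
Qed.

Lemma locm_addN : left_inverse (locm_frac 0 (loc_one S)) locm_opp locm_add.
Proof.
elim/locm_fracW=> a s.
by rewrite locm_oppE locm_addE; apply: locm_frac_eq => /=; module_ring.
Qed.

HB.instance Definition _ :=
  GRing.isZmodule.Build locm locm_addA locm_addC locm_add0 locm_addN.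

Lemma locm_scaleA f g x : locm_scale f (locm_scale g x) = locm_scale (f * g) x.
Proof.
elim/loc_fracW: f => a s; elim/loc_fracW: g => b t; elim/locm_fracW: x => x u.
rewrite -[_ * _]/(loc_mul _ _) loc_mulE !locm_scaleE.
by apply: locm_frac_eq => /=; module_ring.
Qed.

Lemma locm_scale1 : left_id 1 locm_scale.
Proof.
elim/locm_fracW=> x s; rewrite -[1]/(loc_frac 1 (loc_one S)) locm_scaleE.
by apply: locm_frac_eq => /=; module_ring.
Qed.

Lemma locm_scaleDr : right_distributive locm_scale +%R.
Proof.
elim/loc_fracW=> a s; elim/locm_fracW=> x t; elim/locm_fracW=> y u.
rewrite -![_ + _]/(locm_add _ _) !(locm_addE, locm_scaleE).
by apply: locm_frac_eq => /=; module_ring.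
Qed.

Lemma locm_scaleDl x : {morph locm_scale^~ x : a b / a + b}.
Proof.
elim/loc_fracW=> a s; elim/loc_fracW=> b t; elim/locm_fracW: x => x u.
rewrite -[_ + _]/(loc_add _ _) -[X in _ = X]/(locm_add _ _) loc_addE.
by rewrite !(locm_addE, locm_scaleE); apply: locm_frac_eq => /=; module_ring.
Qed.

HB.instance Definition _ := GRing.Zmodule_isLmodule.Build (loc S) locm
  locm_scaleA locm_scale1 locm_scaleDr locm_scaleDl.

Definition locm_map (x : M) : locm := locm_frac x (loc_one S).

Lemma locm_frac_scale x s : locm_frac x s = loc_frac 1 s *: locm_map x.
Proof.
rewrite -[RHS]/(locm_scale _ _) locm_scaleE.
by apply: locm_frac_eq => /=; module_ring.
Qed.

Lemma loc_scale_locm_map a x : loc_map S a *: locm_map x = locm_map (a *: x).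
Proof.
rewrite -[LHS]/(locm_scale _ _) locm_scaleE.
by apply: locm_frac_eq => /=; module_ring.
Qed.

Lemma locm_map_linear : linear (locm_map : M -> restr (loc_map S) locm).
Proof.
move=> a x y; rewrite -[RHS]/(locm_add (loc_map S a *: locm_map x) (locm_map y)).
rewrite loc_scale_locm_map locm_addE.
by apply: locm_frac_eq => /=; module_ring.
Qed.

Lemma locm_map0 x : locm_map x = 0 <-> exists2 u, u \in S & u *: x = 0.
Proof.
rewrite -[0]/(locm_frac 0 (loc_one S)) locm_fracP.
by split=> -[u uS ux]; exists u => //; move: ux; rewrite /= !scale1r subr0.
Qed.

Lemma locm_frac0 x s : locm_frac x s = 0 <-> exists2 u, u \in S & u *: x = 0.
Proof.
rewrite -locm_map0 -[0]/(locm_frac 0 (loc_one S)) !locm_fracP.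
by split=> -[u uS ux]; exists u => //; move: ux; rewrite /= !scale1r !scaler0.
Qed.

End ModuleLocalization.

Section LocalizedMap.
Variables (R : comPzRingType) (S : mulrClosed R) (M M' : lmodType R)
  (f : {linear M -> M'}).

Lemma locm_functor : exists g : {linear locm S M -> locm S M'},
  forall x s, g (locm_frac x s) = locm_frac (f x) s.
Proof.
pose g (z : locm S M) := locm_frac (f (locm_repr z).1) (locm_repr z).2.
have gE x s : g (locm_frac x s) = locm_frac (f x) s.
  have /locm_fracP[u uS E] := locm_reprK (locm_frac x s).
  by apply/locm_fracP; exists u; rewrite // -!linearZ -linearB -linearZ E linear0.
have lg : linear g.
  elim/loc_fracW=> a s; elim/locm_fracW=> x t; elim/locm_fracW=> y u.
  rewrite -[_ *: _]/(locm_scale _ _) -[_ + _]/(locm_add _ _).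
  rewrite -[RHS]/(locm_add (locm_scale _ _) _).
  rewrite !gE !locm_scaleE !locm_addE gE; congr locm_frac.
  by rewrite linearP [X in _ + X]linearZ_LR [f (a *: x)]linearZ_LR.
by exists (mklin lg).
Qed.

End LocalizedMap.

(** * Maximal ideals and local dual bases *)

Section MaximalIdeals.
Variable R : comPzRingType.

Lemma exists_maxideal (J : ideal R) : 1 \notin J ->
  exists m : maxideal R, {subset J <= (m : ideal R)}.
Proof.
(* The empty set qualifies, being the union of the empty chain. *)
move=> J1; pose P (A : set R) := [/\ (forall a x y, A x -> A y -> A (a * x + y)),
  ~ A 1 & forall z, A z -> forall x, x \in J -> A x].
have [F FP Ftot|A [[AP A1 AJ] Amax]] := @Zorn_bigcup R P.
  split=> [a x y [X FX Xx] [Y FY Yy]|[X /FP[_ X1 _] /X1]//|z [X FX Xz] x xJ].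
    have [XY|YX] := Ftot _ _ FX FY.
      by exists Y => //; have [H _ _] := FP _ FY; apply: H => //; apply: XY.
    by exists X => //; have [H _ _] := FP _ FX; apply: H => //; apply: YX.
  by exists X => //; have [_ _ H] := FP _ FX; apply: H xJ; exact: Xz.
have JA x : x \in J -> A x.
  move=> xJ; have [[z Az]|nA] := pselect (exists z, A z); first exact: (AJ z Az).
  exfalso; apply: (Amax [set y | y \in J]%classic).
    by split=> [y Ay|JA]; [case: nA; exists y|apply: nA; exists x; exact: JA].
  split=> [a y z yJ zJ|/=|//]; last exact/negP.
  by apply: rpredD => //; apply: idealM.
have A0 : A 0 by apply/JA/rpred0.
pose I : ideal R := mksub (M := R^o) A0 AP.
have I1 : 1 \notin I by apply/negP => /mksubP.
have Imax (K : ideal R) : {subset I <= K} -> 1 \notin K -> K =i I.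
  move=> IK K1 x; apply/idP/idP => [xK|]; last exact: IK.
  have [//|xI] := boolP (x \in I); exfalso; apply: (Amax [set y | y \in K]%classic).
    split=> [y Ay|KA]; first exact/IK/mksubP.
    by case/negP: xI; apply/mksubP/KA.
  split=> [a y z yK zK|/=|z _ y yJ]; [|exact/negP|exact/IK/mksubP/JA].
  by apply: rpredD => //; apply: idealM.
by exists (MaxIdeal I1 Imax) => x xJ; apply/mksubP/JA.
Qed.

End MaximalIdeals.

Lemma free_coefP (A : pzRingType) (T : choiceType) (a : A) (f g : free_mod A T) t :
  free_coef (a *: f + g) t = a * free_coef f t + free_coef g t.
Proof. by []. Qed.

Section LocalDualBasis.
Variables (R : comPzRingType) (m : maxideal R).

Lemma mlocal_ker (A B : lmodType R) (g : {linear A -> B}) :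
  mlocal m A -> mlocal m B -> mlocal m (submod (lin_ker g)).
Proof.
move=> Al Bl s sm; have [[A0 AS] [B0 _]] := (Al s sm, Bl s sm).
split=> [x sx|y].
  by apply: val_inj; apply: A0; rewrite -[LHS]/(val (s *: x)) sx.
have [x xy] := AS (val y).
have xk : x \in lin_ker g.
  apply/lin_kerP/B0; rewrite -linearZ_LR xy; exact/lin_kerP/valP.
by exists (submk xk); apply: val_inj.
Qed.

Lemma restr_linear (U V : lmodType (locmax m)) (f : {linear U -> V}) :
  linear (f : restr (locmax_map m) U -> restr (locmax_map m) V).
Proof. by move=> a x y; rewrite -[RHS]linearP. Qed.

Lemma projective_almost_projective (P : lmodType R) :
  projective P -> almost_projective P.
Proof.
by move=> Pproj; apply/almost_projective_lift => m' A B g f gs _; apply: Pproj.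
Qed.

Lemma almost_projective_retract (P Q : lmodType R) (i : {linear P -> Q})
    (p : {linear Q -> P}) :
  cancel i p -> almost_projective Q -> almost_projective P.
Proof.
move=> iK /almost_projective_lift Qlift; apply/almost_projective_lift.
move=> m' A B g f gs gl; have [h hE] := Qlift m' A B g (comp_lin f p) gs gl.
by exists (comp_lin h i) => x; rewrite /= hE /= iK.
Qed.

Local Notation Rm := (locmax m).
Local Notation locM M := (locm (max_compl m) M : lmodType Rm).

Local Notation RmR := (restr (locmax_map m) (Rm^o : lmodType Rm)).

(** Lift [M -> M_m] along the free cover of [M_m] over [R_m] and take
    coordinates. *)
Lemma local_dual_basis (M : lmodType R) : almost_projective M ->
  exists (T : choiceType) (phi : T -> {linear M -> RmR}) (b : T -> locM M)
      (supp : M -> seq T),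
    (forall x t, t \notin supp x -> phi t x = 0) /\
    (forall x s, uniq s -> (forall t, t \notin s -> phi t x = 0) ->
       locm_map (max_compl m) x = \sum_(t <- s) (phi t x : Rm) *: b t).
Proof.
move=> /almost_projective_lift /(_ m) lift; pose L := locM M.
pose g := mklin (restr_linear (free_cover L)).
pose f : {linear M -> restr (locmax_map m) L} :=
  mklin (locm_map_linear (max_compl m) (M := M)).
have [||phi phiE] := lift _ _ g f.
- by move=> y; exact: (free_cover_surj (V := L)).
- by apply: mlocal_ker; apply: restr_mlocal.
have coefL (t : L) : linear (fun x => free_coef (phi x : free_mod Rm L) t : RmR).
  move=> a x y; rewrite [phi _]linearP.
  exact: (free_coefP (locmax_map m a) (phi x : free_mod Rm L) (phi y)).
exists L, (fun t => mklin (coefL t)), id, (fun x => free_supp (phi x : free_mod Rm L)).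
split=> [x t|x s s_uniq xs]; first exact: free_suppP.
by rewrite -[LHS](phiE x); apply: free_liftE.
Qed.

End LocalDualBasis.

Section CommonDenominators.
Variables (R : comPzRingType) (m : maxideal R).

(** For clearing finitely many denominators at once. *)
Lemma common_multiple (X : eqType) (l : seq X) (Q : X -> R -> Prop) :
  (forall x s t, t \notin (m : ideal R) -> Q x s -> Q x (t * s)) ->
  (forall x, x \in l -> exists2 s, s \notin (m : ideal R) & Q x s) ->
  exists2 s, s \notin (m : ideal R) & forall x, x \in l -> Q x s.
Proof.
move=> QM; elim: l => [|x l IHl] lQ; first by exists 1 => //; exact: maxideal_proper.
have [|s sm sl] := IHl; first by move=> y yl; apply: lQ; rewrite inE yl orbT.
have [t tm xt] := lQ x (mem_head _ _).
exists (s * t); first exact: (rpredM (s := max_compl m)).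
move=> y; rewrite inE => /orP[/eqP->|/sl]; first exact: QM.
by rewrite mulrC; apply: QM.
Qed.

Lemma loc_num (y : locmax m) : exists s c, s \notin (m : ideal R) /\
  locmax_map m s * y = locmax_map m c.
Proof.
elim/loc_fracW: y => c s; exists (sval s), c; split; first exact: (svalP s).
by rewrite loc_fracE mulrCA loc_map_unit mulr1.
Qed.

Lemma locmax_map0 a : locmax_map m a = 0 <->
  exists2 s, s \notin (m : ideal R) & s * a = 0.
Proof.
rewrite -[0]/(loc_frac 0 (loc_one (max_compl m))) loc_fracP.
by split=> -[s sm E]; exists s => //; move: E; rewrite /= mulr1 mul0r subr0.
Qed.

Lemma locm_max0 (M : lmodType R) (x : M) : locm_map (max_compl m) x = 0 <->
  exists2 s, s \notin (m : ideal R) & s *: x = 0.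
Proof. exact: locm_map0. Qed.

End CommonDenominators.

(** * Coherence from almost projective products *)

Section EquationalCriterion.
Variable R : comPzRingType.

Section RelationSpan.
Variables (M : lmodType R) (n : nat) (a : 'I_n -> R).

Let good (l : seq (('I_n -> R) * M)) :=
  forall cw, cw \in l -> \sum_i a i * cw.1 i = 0.
Let rel_sum (l : seq (('I_n -> R) * M)) : 'I_n -> M :=
  fun i => \sum_(cw <- l) cw.1 i *: cw.2.
Let span (u : 'I_n -> M) : Prop := exists2 l, good l & u = rel_sum l.

Let span0 : span 0.
Proof. by exists [::] => //; apply/funext => i; rewrite /rel_sum big_nil. Qed.

Let spanP b u v : span u -> span v -> span (b *: u + v).
Proof.
move=> [l lg ->] [k kg ->].
exists ([seq (cw.1, b *: cw.2) | cw <- l] ++ k) => [cw|].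
  by rewrite mem_cat => /orP[/mapP[[c w] /lg H ->]|/kg].
apply/funext => i; rewrite -[LHS]/(b *: rel_sum l i + rel_sum k i).
rewrite /rel_sum big_cat big_map scaler_sumr.
by congr (_ + _); apply: eq_bigr => cw _; rewrite /= !scalerA mulrC.
Qed.

(** The image in [M^n] of [K (x) M], where [K] is the module of relations
    between the [a i]. *)
Definition relation_span : submodClosed ('I_n -> M) := mksub span0 spanP.

Lemma relation_spanP u : u \in relation_span <->
  exists p (C : 'I_n -> 'I_p -> R) (w : 'I_p -> M),
    (forall i, u i = \sum_j C i j *: w j) /\ (forall j, \sum_i a i * C i j = 0).
Proof.
split=> [/mksubP[l lg ->]|[p [C [w [uC aC]]]]].
  exists (size l), (fun i j => (tnth (in_tuple l) j).1 i),
    (fun j => (tnth (in_tuple l) j).2).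
  by split=> [i|j]; [rewrite /rel_sum big_tnth|apply: lg; apply: mem_tnth].
apply/mksubP; exists [seq (fun i => C i j, w j) | j <- enum 'I_p].
  by move=> _ /mapP[j _ ->] /=; exact: aC.
by apply/funext => i; rewrite uC /rel_sum big_map big_enum.
Qed.

End RelationSpan.

(** The elements [s] such that [s u] satisfies the conclusion form an ideal.
    It lies in no maximal ideal [m]: the coordinates of [u] in a local dual
    basis are relations between the [a i] over [R_m], and clearing denominators
    produces an [s] outside [m]. *)
Lemma almost_projective_eq_flat (M : lmodType R) : almost_projective M -> eq_flat M.
Proof.
move=> Map n a u au.
pose K := relation_span M a.
have Js0 : 0 *: u \in K by rewrite scale0r; exact: rpred0.
have JsP b s t : s *: u \in K -> t *: u \in K -> (b * s + t) *: u \in K.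
  by move=> sK tK; rewrite scalerDl -scalerA rpredD // rpredZ.
pose J : ideal R := mksub (M := R^o) Js0 JsP.
suff /mksubP : 1 \in J by rewrite scale1r => /relation_spanP.
apply/negPn/negP => /exists_maxideal[m Jm].
have [T [phi [b [supp [phi0 phiE]]]]] := local_dual_basis m Map.
have phi_sum t : \sum_i locmax_map m (a i) * phi t (u i) = 0.
  transitivity (phi t (\sum_i a i *: u i)); last by rewrite au linear0.
  by rewrite linear_sum; apply: eq_bigr => i _; rewrite linearZ_LR.
pose l := undup (flatten [seq supp (u i) | i : 'I_n]).
have lE i : locm_map (max_compl m) (u i) =
    \sum_(t <- l) (phi t (u i) : locmax m) *: b t.
  apply: phiE => [|t tl]; first exact: undup_uniq.
  apply: phi0; apply: contra tl => tl; rewrite mem_undup; apply/flattenP.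
  by exists (supp (u i)) => //; apply: map_f; rewrite mem_enum.
have [||d dm dP] := common_multiple (m := m)
   (l := [seq (i, t) | i <- enum 'I_n, t <- l])
   (Q := fun it s => exists c, locmax_map m s * phi it.2 (u it.1) = locmax_map m c).
- by move=> [i t] s s' _ [c sc]; exists (s' * c); rewrite !rmorphM -mulrA sc.
- move=> [i t] _; have [s [c [sm sc]]] := loc_num (phi t (u i)).
  by exists s => //; exists c.
have cex (it : 'I_n * T) : exists e, it.2 \in l ->
    locmax_map m d * phi it.2 (u it.1) = locmax_map m e.
  case: it => i t /=; have [tl|] := boolP (t \in l); last by exists 0.
  by have [|e eE] := dP (i, t); [apply: allpairs_f; rewrite // mem_enum|exists e].
have [c cE] := boolp.choice cex.
have [||d2 d2m d2P] := common_multiple (m := m) (l := l)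
   (Q := fun t s => s * (\sum_i a i * c (i, t)) = 0).
- by move=> t s s' _ st; rewrite -mulrA st mulr0.
- move=> t tl; apply/locmax_map0; rewrite rmorph_sum.
  transitivity (locmax_map m d * \sum_i locmax_map m (a i) * phi t (u i)).
    by rewrite mulr_sumr; apply: eq_bigr => i _; rewrite rmorphM -(cE (i, t)) // mulrCA.
  by rewrite phi_sum mulr0.
have [||d3 d3m d3P] := common_multiple (m := m) (l := l)
   (Q := fun t s => exists w, locmax_map m s *: b t = locm_map (max_compl m) w).
- move=> t s s' _ [w sw]; exists (s' *: w).
  by rewrite rmorphM -scalerA sw; exact: loc_scale_locm_map.
- move=> t _; elim/locm_fracW: (b t) => w s; exists (sval s); first exact: (svalP s).
  exists w; rewrite locm_frac_scale scalerA loc_map_unit scale1r //.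
have wex t : exists w, t \in l -> locmax_map m d3 *: b t = locm_map (max_compl m) w.
  have [tl|] := boolP (t \in l); last by exists 0.
  by have [e eE] := d3P t tl; exists e.
have [w wE] := boolp.choice wex.
(* [d] clears the denominators of the coordinates of the [u i], [d2] makes
   their numerators relations in [R], [d3] clears those of the [b t]. *)
pose D := d2 * d * d3.
have [||d4 d4m d4P] := common_multiple (m := m) (l := enum 'I_n)
   (Q := fun i s => s *: (D *: u i - \sum_(t <- l) (d2 * c (i, t)) *: w t) = 0).
- by move=> i s s' _ si; rewrite -scalerA si scaler0.
- move=> i _; apply/locm_max0.
  pose f := mklin (locm_map_linear (max_compl m) (M := M)).
  rewrite -[LHS]/(f _) linearB linear_sum; apply/eqP; rewrite subr_eq0; apply/eqP.
  have fZ a0 x : f (a0 *: x) =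
      locmax_map m a0 *: (locm_map (max_compl m) x : locm (max_compl m) M).
    exact: (linearZ_LR f).
  rewrite fZ lE scaler_sumr; apply: eq_big_seq => t tl; rewrite fZ.
  rewrite -wE // !scalerA; congr (_ *: _).
  by rewrite !rmorphM -(cE (i, t)) //; ring.
have /Jm : d4 * D \in J.
  apply/mksubP/relation_spanP.
  exists (size l), (fun i j => d4 * (d2 * c (i, tnth (in_tuple l) j))),
    (fun j => w (tnth (in_tuple l) j)).
  split=> [i|j]; last first.
    set t := tnth _ _; have tl : t \in l by exact: mem_tnth.
    transitivity (d4 * (d2 * \sum_i a i * c (i, t))); last by rewrite d2P ?mulr0.
    by rewrite !mulr_sumr; apply: eq_bigr => i _; ring.
  have := d4P i (mem_enum _ i); rewrite scalerBr scalerA => /eqP.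
  rewrite subr_eq0 => /eqP E; rewrite -[LHS]/((d4 * D) *: u i) E scaler_sumr big_tnth.
  by apply: eq_bigr => t _; rewrite scalerA.
have [_ mM] := max_compl_closed m.
by apply/negP; exact: (mM _ _ d4m (mM _ _ (mM _ _ d2m dm) d3m)).
Qed.

(** Apply the equational criterion in [R^X], [X] the set of relations, to the
    tautological relation [u i = (v |-> v i)]. *)
Lemma products_relations_fg :
  (forall T : Type, almost_projective (T -> R^o)) -> relations_fg R.
Proof.
move=> prodAP n a; pose X := {v : 'I_n -> R | \sum_i a i * v i = 0}.
pose u (i : 'I_n) : X -> R^o := fun v => sval v i.
have au0 : \sum_i a i *: u i = 0 by apply/funext => -[v av]; rewrite fun_sumE.
have [p [C [w [uC aC]]]] := almost_projective_eq_flat (prodAP X) au0.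
exists p, C; split=> // v av; pose x : X := exist _ v av.
exists (fun j => w j x) => i.
by rewrite -[LHS]/(u i x) uC fun_sumE.
Qed.

(** Each coordinate of [R^T] factors through a preenvelope, and together these
    factorizations form a retraction. *)
Lemma envelopes_products (T : Type) :
  (forall M : lmodType R, has_envelope (@almost_projective R) M) ->
  almost_projective (T -> R^o).
Proof.
move=> /(_ (T -> R^o)) [P [f [[APP fP] _]]].
have ARo : almost_projective R^o.
  apply: projective_almost_projective => A B g h gs.
  have [x xE] := gs (h 1).
  exists (mklin (fun a (y z : R^o) => etrans (scalerDl x (a * y) z)
     (congr1 (fun w => w + z *: x) (esym (scalerA a y x))))) => y.
  by rewrite mklinE linearZ_LR xE -linearZ_LR; congr (h _); exact: mulr1.
have coordL t : linear (fun y : T -> R^o => y t) by [].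
have gex t := fP R^o (mklin (coordL t)) ARo.
have [g gE] := boolp.choice gex.
have GL : linear (fun (x : P) t => g t x).
  by move=> a x y; apply/funext => t; rewrite linearP.
apply: (almost_projective_retract (i := f) (p := mklin GL)) => // y.
by apply/funext => t; rewrite mklinE gE.
Qed.

End EquationalCriterion.

Section Coherence.
Variable R : comPzRingType.

Definition comb (n : nat) (M : lmodType R) (a : 'I_n -> M) (v : 'rV[R]_n) : M :=
  \sum_i v 0 i *: a i.

Lemma comb_linear (n : nat) (M : lmodType R) (a : 'I_n -> M) : linear (comb a).
Proof.
move=> c u v; rewrite /comb scaler_sumr -big_split; apply: eq_bigr => i _.
by rewrite !mxE scalerDl scalerA.
Qed.

Lemma rV_comb n (M : lmodType R) (p : {linear 'rV[R]_n -> M}) v :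
  p v = \sum_i v 0 i *: p (delta_mx 0 i).
Proof.
rewrite {1}[v]row_sum_delta linear_sum; apply: eq_bigr => i _.
by rewrite linearZ.
Qed.

Lemma relations_fg_coherent : relations_fg R -> coherent R.
Proof.
move=> fgR I [n [p ps]]; pose a i : R := val (p (delta_mx 0 i)).
have [k [C [aC Cgen]]] := fgR n a.
have pE v : val (p v) = \sum_i a i * v 0 i.
  rewrite rV_comb -[LHS]/(incl _ _) linear_sum; apply: eq_bigr => i _.
  by rewrite linearZ_LR mulrC.
exists k, n, (mklin (comb_linear (fun j => \row_i C i j))), p; split=> // v.
split=> [pv|[w <-]].
  have [|z zE] := Cgen (fun i => v 0 i); first by rewrite -pE pv.
  exists (\row_j z j); apply/rowP => i; rewrite mklinE /comb summxE zE.
  by apply: eq_bigr => j _; rewrite !mxE mulrC.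
apply: val_inj; rewrite pE mklinE /comb.
under eq_bigr => i _.
  rewrite summxE mulr_sumr; under eq_bigr => j _ do rewrite !mxE mulrCA.
  over.
rewrite exchange_big big1 // => j _ /=.
by rewrite -mulr_sumr aC mulr0.
Qed.

(** Schanuel: a finite presentation [p], [q] of the ideal of the [a i] and the
    given generators are compared by [al] and [be]; the relations come from
    the differences [delta_mx 0 i - c (al i)] and from the images of the given
    relations [q]. *)
Lemma coherent_relations_fg : coherent R -> relations_fg R.
Proof.
move=> cohR l a; pose I := lin_im (mklin (comb_linear (a : 'I_l -> R^o))).
have aI i : a i \in I.
  apply/lin_imP; exists (delta_mx 0 i); rewrite mklinE /comb (bigD1 i) //= mxE !eqxx.
  rewrite scale1r big1 ?addr0 // => j ji.
  by rewrite mxE (negPf ji) andbF scale0r.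
pose aS i : submod I := submk (aI i).
have combE v : val (comb aS v) = \sum_i a i * v 0 i.
  rewrite -[LHS]/(incl _ _) linear_sum; apply: eq_bigr => i _.
  by rewrite linearZ_LR mulrC.
have comb_surj : surj (comb aS).
  move=> x; have /lin_imP[v vx] : val x \in I by exact: valP.
  exists v; apply: val_inj; rewrite combE -vx mklinE /comb.
  by apply: eq_bigr => i _; rewrite mulrC.
have [|k [n [q [p [ps kerp]]]]] := cohR I.
  by exists l, (mklin (comb_linear aS)).
have [al alE] := boolp.choice (fun i => ps (aS i)).
have [be beE] := boolp.choice (fun j => comb_surj (p (delta_mx 0 j))).
have [b bS] : exists b : {linear 'rV[R]_l -> submod I}, forall x, b x = comb aS x.
  by exists (mklin (comb_linear aS)).
have [c cS] : exists c : {linear 'rV[R]_n -> 'rV[R]_l}, forall x, c x = comb be x.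
  by exists (mklin (comb_linear be)).
have bc x : b (c x) = p x.
  rewrite cS linear_sum [RHS]rV_comb; apply: eq_bigr => j _.
  by rewrite linearZ_LR bS -beE.
have bE i : b (delta_mx 0 i) = aS i.
  by apply: val_inj; rewrite bS combE (bigD1 i) //= mxE !eqxx mulr1 big1
    ?addr0 // => j ji; rewrite mxE (negPf ji) andbF mulr0.
pose G (s : 'I_(l + k)) : 'rV[R]_l := match fintype.split s with
  | inl i => delta_mx 0 i - c (al i) | inr h => c (q (delta_mx 0 h)) end.
have bG s : b (G s) = 0.
  rewrite /G; case: fintype.split => [i|h]; first by rewrite linearB bE bc alE subrr.
  by rewrite bc; apply/kerp; exists (delta_mx 0 h).
exists (l + k)%N, (fun i s => G s 0 i); split=> [s|v av].
  by rewrite -combE -bS bG.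
have [w wE] : exists w, q w = \sum_i v i *: al i.
  apply/kerp; rewrite linear_sum; apply: val_inj.
  rewrite -[LHS]/(incl I _) linear_sum -[RHS]av; apply: eq_bigr => i _.
  by rewrite linearZ_LR alE linearZ_LR mulrC.
exists (fun s => match fintype.split s with inl i => v i | inr h => w 0 h end) => i.
rewrite big_split_ord /= /G.
under eq_bigr => j _ do rewrite (unsplitK (inl j)).
under [X in _ + X]eq_bigr => j _ do rewrite (unsplitK (inr j)).
pose x : 'rV[R]_l := \row_i v i.
have -> : v i = x 0 i by rewrite mxE.
have -> : x = \sum_j v j *: (delta_mx 0 j - c (al j)) +
              \sum_h w 0 h *: c (q (delta_mx 0 h)).
  have -> : \sum_h w 0 h *: c (q (delta_mx 0 h)) = c (\sum_j v j *: al j).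
    rewrite -wE [q w]rV_comb linear_sum; apply: eq_bigr => h _.
    by rewrite linearZ_LR.
  rewrite linear_sum -big_split [LHS]row_sum_delta; apply: eq_bigr => j _ /=.
  by rewrite linearZ_LR -scalerDr subrK mxE.
by rewrite mxE !summxE; congr (_ + _); apply: eq_bigr => j _; rewrite mxE mulrC.
Qed.

End Coherence.

(** * T-nilpotence from almost projective products *)

Section LocalRing.
Variables (R : comPzRingType) (m : maxideal R).
Local Notation Rm := (locmax m).
Local Notation M_ := (m : ideal R).

Definition max_den s (sm : s \notin M_) : {s : R | s \in max_compl m} := exist _ s sm.

(** Membership in the maximal ideal of [R_m]. *)
Definition inM (y : Rm) : Prop :=
  exists s a, [/\ s \notin M_, a \in M_ & locmax_map m s * y = locmax_map m a].

Lemma max_complM s t : s \notin M_ -> t \notin M_ -> s * t \notin M_.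
Proof. exact: (max_compl_closed m).2. Qed.

Lemma inM0 : inM 0.
Proof.
exists 1, 0; rewrite mulr0 rmorph0 rpred0; split=> //; exact: maxideal_proper.
Qed.

Lemma inMD x y : inM x -> inM y -> inM (x + y).
Proof.
move=> [s [a [sm am sx]]] [t [b [tm bm ty]]]; exists (s * t), (t * a + s * b).
split; [exact: max_complM|by rewrite rpredD ?idealM|].
by rewrite !(rmorphM, rmorphD) -sx -ty /=; ring.
Qed.

Lemma inMl x y : inM y -> inM (x * y).
Proof.
move=> [t [b [tm bm ty]]]; have [s [a [sm sx]]] := loc_num x.
exists (s * t), (a * b); split; [exact: max_complM|exact: idealM|].
by rewrite !rmorphM -sx -ty /=; ring.
Qed.

Lemma inM_map a : inM (locmax_map m a) <-> a \in M_.
Proof.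
split=> [[s [b [sm bm]]]|am]; last first.
  by exists 1, a; rewrite rmorph1 mul1r; split=> //; exact: maxideal_proper.
move=> /eqP; rewrite -rmorphM -subr_eq0 -rmorphB => /eqP/locmax_map0[t tm /eqP].
rewrite mulrBr subr_eq0 => /eqP E; apply/negPn/negP => am.
by case/negP: (max_complM tm (max_complM sm am)); rewrite E idealM.
Qed.

Lemma unit_or_inM x : (exists y, x * y = 1) \/ inM x.
Proof.
have [s [a [sm sx]]] := loc_num x.
have [am|am] := boolP (a \in M_); [right; by exists s, a|left].
exists (locmax_map m s * loc_frac 1 (max_den am)).
by rewrite mulrA [x * _]mulrC sx (loc_map_unit (max_den am)).
Qed.

Lemma unit_not_inM x y : x * y = 1 -> ~ inM x.
Proof.
move=> xy xM; have := inMl y xM; rewrite mulrC xy -(rmorph1 (locmax_map m)).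
by move=> /inM_map; apply/negP; exact: maxideal_proper.
Qed.

Lemma not_inM_cancel x y : ~ inM x -> y * x = 0 -> y = 0.
Proof.
move=> xM yx; have [[z xz]|//] := unit_or_inM x.
by rewrite -[y]mulr1 -xz mulrA yx mul0r.
Qed.

(** T-nilpotence of [m R_m], expressed in [R]. *)
Definition t_nilpotent : Prop := forall a : nat -> R, (forall n, a n \in M_) ->
  exists n s, s \notin M_ /\ s * \prod_(0 <= i < n) a i = 0.

(** The localization of a functional. *)
Lemma loc_functional (M : lmodType R) (f : {linear M -> R^o}) :
  exists g : {linear locm (max_compl m) M -> Rm^o},
    forall x, g (locm_map (max_compl m) x) = locmax_map m (f x).
Proof.
pose g (z : locm (max_compl m) M) : Rm^o :=
  (loc_frac (f (locm_repr z).1 : R) (locm_repr z).2 : Rm).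
have gE x s : g (locm_frac x s) = (loc_frac (f x : R) s : Rm).
  have /locm_fracP[u uS E] := locm_reprK (locm_frac x s).
  apply/loc_fracP; exists u => //.
  transitivity (f (u *: (sval s *: (locm_repr (locm_frac x s)).1 -
     sval (locm_repr (locm_frac x s)).2 *: x))); last by rewrite E linear0.
  rewrite linearZ_LR linearB !(linearZ_LR f); apply: (congr1 ( *%R u)).
  by apply: (congr2 (fun p q : R => p - q)); exact: mulrC.
have lg : linear g.
  elim/loc_fracW=> a s; elim/locm_fracW=> x t; elim/locm_fracW=> y u.
  rewrite -[_ *: _]/(locm_scale _ _) -[_ + _]/(locm_add _ _).
  rewrite locm_scaleE locm_addE !gE -[RHS]/(loc_add (loc_mul _ _) _).
  rewrite loc_mulE loc_addE; congr loc_frac.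
  by rewrite linearD !(linearZ_LR f); apply: (congr2 +%R); exact: mulrC.
by exists (mklin lg) => x; exact: gE.
Qed.

Section TNilpotent.
Variables (T : choiceType)
  (phi : T -> {linear (nat -> R^o) -> restr (locmax_map m) (Rm^o : lmodType Rm)})
  (b : T -> locm (max_compl m) (nat -> R^o)) (supp : (nat -> R^o) -> seq T).
Hypotheses (phi0 : forall x t, t \notin supp x -> phi t x = 0)
  (phiE : forall x s, uniq s -> (forall t, t \notin s -> phi t x = 0) ->
       locm_map (max_compl m) x = \sum_(t <- s) (phi t x : Rm) *: (b t : locm _ _ )).

Let phiP t a x y : phi t (a *: x + y) = locmax_map m a * phi t x + phi t y :> Rm.
Proof. exact: linearP. Qed.

(** Induction on the number of functionals: take a solution [y] for the others
    and one [y'] supported beyond an index where [y] is outside [m]; if neither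
    works for the new functional, then a combination of them with coefficients
    outside [m] is annihilated by it. *)
Lemma functionals_vanish (l : seq T) n : exists y : nat -> R^o,
  [/\ forall k, (k < n)%N -> y k = 0, exists x, y x \notin M_
    & forall t, t \in l -> inM (phi t y)].
Proof.
elim: l n => [|t l IHl] n.
  exists (fun k => (k == n)%:R); split=> // [k kn|]; first by rewrite ltn_eqF.
  by exists n; rewrite eqxx; exact: maxideal_proper.
have [y [y0 [x yx] yl]] := IHl n.
(* As [y' x = 0], combinations of [y] and [y'] are controlled by [y] at [x]. *)
have [y' [y'0 yx' yl']] := IHl (maxn n x.+1).
have y'n k : (k < n)%N -> y' k = 0 by move=> kn; rewrite y'0 // leq_max kn.
have [My|nMy] := pselect (inM (phi t y)).
  by exists y; split=> // [|u]; [exists x|rewrite inE => /orP[/eqP->|/yl]].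
have [My'|nMy'] := pselect (inM (phi t y')).
  by exists y'; split=> // u; rewrite inE => /orP[/eqP->|/yl'].
have [s [c [sm sc]]] := loc_num (phi t y).
have [s' [c' [sm' sc']]] := loc_num (phi t y').
have cm : c \notin M_ by apply/negP => cm; apply: nMy; exists s, c.
have cm' : c' \notin M_ by apply/negP => cm'; apply: nMy'; exists s', c'.
exists ((s * c') *: y + (- (s' * c)) *: y'); split=> [k kn||u].
- by rewrite -[LHS]/((s * c') * y k + (- (s' * c)) * y' k) y0 // y'n // !mulr0 addr0.
- exists x; rewrite -[X in X \notin _]/((s * c') * y x + (- (s' * c)) * y' x).
  rewrite y'0 ?leq_max ?ltnS ?leqnn ?orbT // mulr0 addr0.
  by rewrite !max_complM.
have phiS v : phi v ((s * c') *: y + (- (s' * c)) *: y') =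
    locmax_map m (s * c') * phi v y + locmax_map m (- (s' * c)) * phi v y' :> Rm.
  by rewrite phiP; congr (_ + _); exact: linearZ_LR.
rewrite inE phiS => /orP[/eqP->|ul]; last first.
  by apply: inMD; apply: inMl; [exact: yl|exact: yl'].
have -> : locmax_map m (s * c') * phi t y +
    locmax_map m (- (s' * c)) * phi t y' = 0 :> Rm.
  rewrite rmorphN !rmorphM.
  transitivity (locmax_map m c' * (locmax_map m s * phi t y) -
     locmax_map m c * (locmax_map m s' * phi t y')); first by ring.
  by rewrite sc sc' mulrC subrr.
exact: inM0.
Qed.

(** Otherwise all coordinates of the sequence [y] given by
    [functionals_vanish] are in [m R_m], and so are its values. *)
Lemma unit_coordinate (l : seq T) n : exists (yt : (nat -> R^o) * T),
  [/\ forall k, (k < n)%N -> yt.1 k = 0, yt.2 \notin l & ~ inM (phi yt.2 yt.1)].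
Proof.
have [y [y0 [x yx] yl]] := functionals_vanish l n.
apply: contrapT => none.
have yM t : inM (phi t y).
  have [tl|tl] := boolP (t \in l); first exact: yl.
  by apply: contrapT => tM; apply: none; exists (y, t).
case/negP: yx; apply/inM_map.
have xL : linear (fun z : nat -> R^o => z x) by [].
have [g gE] := loc_functional (mklin xL).
rewrite -[y x]/(mklin xL y) -gE.
rewrite (phiE (s := undup (supp y)) (undup_uniq _)).
  rewrite linear_sum; elim/big_ind: _ => [|u v|t _]; [exact: inM0|exact: inMD|].
  rewrite linearZ_LR -[_ *: _]/((phi t y : Rm) * _) mulrC; exact: inMl.
by move=> t; rewrite mem_undup; apply: phi0.
Qed.

(** Let [B n] be the product of the first [n] terms and suppose that no [B n]
    vanishes in [R_m].  Choose sequences [y n] that start at [n] and indices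
    [t n] such that the coordinate of [y n] at [t n] is a unit while that of
    [y k], [k < n], is [0].  The coordinate of [\sum_n B n * y n] at [t n] is
    then [B n] times a unit, for all [n]; but only finitely many coordinates of
    an element are nonzero. *)
Lemma product_t_nilpotent : t_nilpotent.
Proof.
move=> a am; apply: contrapT => none.
pose B n := \prod_(0 <= i < n) a i.
have BN n : locmax_map m (B n) <> 0.
  by move=> /locmax_map0[s sm sB]; apply: none; exists n, s.
have [F FP] := boolp.choice (fun ln : seq T * nat => unit_coordinate ln.1 ln.2).
(* [E n] contains the indices of all nonzero coordinates of the earlier
   [y k]. *)
pose E := fix E n := if n is k.+1 then E k ++ supp (F (E k, k)).1 else [::].
pose y n := (F (E n, n)).1; pose t n := (F (E n, n)).2.
have Esub k n : (k <= n)%N -> {subset E k <= E n}.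
  elim: n => [|n IHn]; first by rewrite leqn0 => /eqP->.
  rewrite leq_eqVlt => /orP[/eqP->//|/IHn kn] u /kn un.
  by rewrite /= mem_cat un.
have y0 n k : (k < n)%N -> y n k = 0 by case: (FP (E n, n)) => /(_ k).
have tE n : t n \notin E n by case: (FP (E n, n)).
have tM n : ~ inM (phi (t n) (y n)) by case: (FP (E n, n)).
have t_supp n x : phi (t n) x <> 0 :> Rm -> t n \in supp x.
  by move=> tx; apply/negPn/negP => /phi0.
have tS n : t n \in E n.+1.
  rewrite /= mem_cat t_supp ?orbT // => tx; apply: (tM n); rewrite tx; exact: inM0.
have t_inj : injective t.
  suff H k n : (k < n)%N -> t k <> t n.
    move=> k n tkn; apply/eqP; case: ltngtP => // kn.
      by case: (H _ _ kn).
    by case: (H _ _ kn).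
  move=> kn tkn; case/negP: (tE n); rewrite -tkn; exact: Esub (tS k).
have phi_lt k n : (k < n)%N -> phi (t n) (y k) = 0.
  move=> kn; apply: phi0; apply: contra (tE n) => tn; apply: (Esub k.+1) => //.
  by rewrite /= mem_cat tn orbT.
pose z : nat -> R^o := fun x => \sum_(0 <= k < x.+1) B k * y k x.
have zN x N : (x < N)%N -> z x = \sum_(0 <= k < N) B k * y k x.
  move=> xN; rewrite (big_cat_nat (n := x.+1)) //= [X in _ + X]big_nat_cond.
  rewrite [X in _ + X]big1 ?addr0 //.
  by move=> k /andP[/andP[xk _] _]; rewrite y0 // mulr0.
have zt n : phi (t n) z <> 0 :> Rm.
  pose z' : nat -> R^o := fun x => \sum_(n.+1 <= k < maxn n.+1 x.+1)
    (\prod_(n.+1 <= i < k) a i) * y k x.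
  (* At [t n] only [y n] and the tail matter, and the tail is a multiple of
     [B n.+1]. *)
  have zE : z = (\sum_(0 <= k < n) B k *: y k) + (B n *: y n + B n.+1 *: z').
    apply/funext => x; rewrite (zN x (maxn n.+1 x.+1)) ?leq_max ?leqnn ?orbT //.
    rewrite (big_cat_nat (n := n.+1)) ?leq_max ?leqnn //= big_nat_recr //= -addrA.
    rewrite -[RHS]/((\sum_(0 <= k < n) B k *: y k) x + (B n * y n x + B n.+1 * z' x)).
    rewrite fct_sumE; congr (_ + (_ + _)); rewrite /z' mulr_sumr.
    apply: eq_big_nat => k /andP[nk _]; rewrite mulrA; congr (_ * _).
    by rewrite /B -big_cat_nat.
  have -> : phi (t n) z = locmax_map m (B n) *
      (phi (t n) (y n) + locmax_map m (a n) * phi (t n) z') :> Rm.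
    rewrite zE linearD linear_sum big_nat_cond big1 ?add0r.
      rewrite [LHS]phiP [X in _ + X]linearZ_LR mulrDr; congr (_ + _).
      by rewrite mulrA -rmorphM /B big_nat_recr.
    by move=> k /andP[/andP[_ kn] _]; rewrite linearZ_LR phi_lt // scaler0.
  move=> /not_inM_cancel-/(_ _)/BN; apply => yM; apply: (tM n).
  have -> : (phi (t n) (y n) : Rm) =
      (phi (t n) (y n) + locmax_map m (a n) * phi (t n) z') +
      (- phi (t n) z') * locmax_map m (a n) by ring.
  by apply: inMD => //; apply: inMl; apply/inM_map.
have := @uniq_leq_size _ (map t (iota 0 (size (supp z)).+1)) (supp z).
rewrite map_inj_uniq ?iota_uniq // size_map size_iota ltnn; move=> H.
have : false; last by [].
by apply: H => // _ /mapP[n _ ->]; exact: t_supp.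
Qed.

End TNilpotent.
End LocalRing.

Lemma almost_projective_t_nilpotent (R : comPzRingType) (m : maxideal R) :
  almost_projective (nat -> R^o) -> t_nilpotent m.
Proof.
move=> AP; have [T [phi [b [supp [phi0 phiE]]]]] := local_dual_basis m AP.
exact: (product_t_nilpotent phi0 phiE).
Qed.

(** * Artinian local rings *)

Lemma idealD (A : pzRingType) (V : ideal A) (x y : A) :
  x \in V -> y \in V -> x + y \in V.
Proof. exact: rpredD. Qed.

Lemma ideal0 (A : pzRingType) (V : ideal A) : (0 : A) \in V.
Proof. exact: rpred0. Qed.

Section Nilpotence.
Variables (A : comPzRingType) (I : finType) (c : I -> A).

(** A product with more than [\sum_i d i] factors contains some [c i] at least
    [d i] times. *)
Lemma kills_nilpotent (d : I -> nat) : (forall i, c i ^+ d i = 0) ->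
  exists N, kills c N 1.
Proof.
move=> cd; exists (\sum_i d i).+1.
suff H n (e : I -> nat) p : (\sum_i e i)%N = n ->
    (forall i, p * c i ^+ e i = 0) -> kills c n.+1 p.
  by apply: (H _ d) => // i; rewrite mul1r.
clear d cd; elim: n e p => [|n IHn] d p dn pd i.
  move/eqP: dn; rewrite sum_nat_eq0 => /forallP/(_ i)/eqP /= di.
  by have := pd i; rewrite di mulr1 => ->; rewrite /= mul0r.
case: (posnP (d i)) => [di|di].
  have := pd i; rewrite di mulr1 => ->; rewrite mul0r.
  have k0 k : kills c k 0 by elim: k => //= k IHk j; rewrite mul0r.
  exact: (k0 n.+1).
apply: (IHn (fun j => d j - (j == i))%N) => [|j].
  move: dn; rewrite (bigD1 i) //= [X in _ -> X = _](bigD1 i) //= eqxx => dn.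
  under eq_bigr => j ji do rewrite (negPf ji) subn0.
  by move: dn; rewrite -(prednK di) addSn subn1 => -[].
case: eqVneq => [->|ji]; last by rewrite subn0 -mulrA mulrCA pd mulr0.
by rewrite -mulrA -exprS subn1 prednK // pd.
Qed.

Section Artinian.
Variable N : nat.
Hypotheses (cN : kills c N 1)
  (local : forall y : A, (exists z, y * z = 1) \/ inJ c (y : A^o)).

Let stable (V : ideal A) : Prop := forall K : nat -> ideal A,
  (forall n, {subset K n.+1 <= K n}) ->
  exists n, forall k, (n <= k)%N -> forall y, y \in V -> y \in K n -> y \in K k.

Let chain_sub (K : nat -> ideal A) n k : (forall n, {subset K n.+1 <= K n}) ->
  (n <= k)%N -> {subset K k <= K n}.
Proof.
move=> Kd; elim: k => [|k IHk]; first by rewrite leqn0 => /eqP->.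
by rewrite leq_eqVlt => /orP[/eqP->//|/IHk nk] y /Kd/nk.
Qed.

(** If [J p] lies in [V], then [(V + A p) / V] is at most a line over the residue
    field: a chain either avoids it from some point on or covers it. *)
Let stable_extend (V : ideal A) p : stable V -> (forall i, p * c i \in V) ->
  exists W : ideal A, [/\ stable W, {subset V <= W} & p \in W].
Proof.
move=> Vst pV.
pose S (y : A^o) := exists a : A, (y : A) - a * p \in V.
have S0 : S 0 by exists 0; rewrite mul0r subr0; exact: ideal0.
have SP (a : A) (x y : A^o) : S x -> S y -> S (a *: x + y).
  move=> [b xV] [e yV]; exists (a * b + e); rewrite -[a *: x]/((a : A) * x).
  rewrite (_ : _ - _ = a * (x - b * p) + (y - e * p)); last by ring.
  by apply: idealD => //; apply: idealM.
pose W : ideal A := mksub S0 SP.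
have WP y : y \in W <-> exists a, y - a * p \in V by exact: (mksubP S0 SP).
have JV a : inJ c (a : A^o) -> a * p \in V.
  move=> [w ->]; rewrite mulr_suml; apply: rpred_sum => i _.
  rewrite -[c i *: w i]/(c i * w i) -mulrA mulrC -mulrA; exact: idealM.
exists W; split=> [K Kd|x xV|]; last 2 first.
- by apply/WP; exists 0; rewrite mul0r subr0.
- by apply/WP; exists 1; rewrite mul1r subrr; exact: ideal0.
have [n0 n0P] := Vst K Kd.
have [[n1 n1P]|none] := pselect (exists n1, forall y, y \in W -> y \in K n1 -> y \in V).
  exists (maxn n0 n1) => k; rewrite geq_max => /andP[n0k n1k] y yW yK.
  have yV : y \in V by apply: n1P => //; apply: chain_sub yK => //; exact: leq_maxr.
  by apply: n0P => //; apply: chain_sub yK => //; exact: leq_maxl.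
exists n0 => k n0k y /WP[a yV] yK.
have [w [/WP[b wV] wK wNV]] : exists w, [/\ w \in W, w \in K k & w \notin V].
  apply: contrapT => H; apply: none; exists k => w wW wK.
  by apply/negPn/negP => wV; apply: H; exists w.
have [[z bz]|/JV bJ] := local b; last first.
  by case/negP: wNV; rewrite -(subrK (b * p) w); apply: idealD.
have : y - a * z * w \in K k.
  apply: n0P => //; last first.
    by apply: submodB => //; apply: idealM; exact: chain_sub wK.
  rewrite (_ : _ - _ = (y - a * p) - a * z * (w - b * p) + a * (1 - b * z) * p);
    last by ring.
  by rewrite bz subrr mulr0 mul0r addr0; apply: submodB => //; apply: idealM.
by move=> yzK; rewrite -(subrK (a * z * w) y); apply: idealD => //; apply: idealM.
Qed.

(** Starting from the zero ideal, adjoin the monomials in the generators by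
    decreasing degree, down to [1]; each step preserves the descending chain
    condition. *)
Lemma local_artinian : artinian A.
Proof.
(* [p J^n] is contained in [V]. *)
pose fix inn (n : nat) (p : A) (V : ideal A) {struct n} : Prop :=
  if n is k.+1 then forall i, inn k (p * c i) V else p \in V.
have innS n p (V W : ideal A) : {subset V <= W} -> inn n p V -> inn n p W.
  by move=> VW; elim: n p => [p /VW|n IHn p pV i] //; apply: IHn.
have main n p (V : ideal A) : stable V -> inn n p V ->
    exists W : ideal A, [/\ stable W, {subset V <= W} & p \in W].
  elim: n p V => [|n IHn] p V Vst pV; first by exists V; split.
  have [W [Wst VW pW]] : exists W : ideal A, [/\ stable W, {subset V <= W} &
      forall i, i \in enum I -> p * c i \in W].
    elim: (enum I) => [|i l [W [Wst VW lW]]]; first by exists V; split.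
    have [U [Ust WU iU]] := IHn (p * c i) W Wst (innS _ _ _ _ VW (pV i)).
    exists U; split=> // [x /VW/WU//|j]; rewrite inE => /orP[/eqP->//|/lW].
    exact: WU.
  have [|U [Ust WU pU]] := stable_extend (p := p) Wst.
    by move=> i; apply: pW; rewrite mem_enum.
  by exists U; split=> // x /VW/WU.
have S0 : (0 : A^o) = 0 by [].
have SP (a : A) (x y : A^o) : x = 0 -> y = 0 -> a *: x + y = 0.
  by move=> -> ->; rewrite scaler0 addr0.
pose Z : ideal A := mksub S0 SP.
have [K _||W [Wst _ W1]] := main N 1 Z.
- by exists 0%N => k _ y /mksubP-> _; exact: ideal0.
- have inn0 n p : kills c n p -> inn n p Z.
    by elim: n p => [p /= p0|n IHn p pk i]; [exact/asboolP|exact: IHn (pk i)].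
  exact: inn0.
move=> K Kd; have [n nP] := Wst K Kd; exists n => k nk y.
apply/idP/idP => [|yK]; first exact: chain_sub.
by apply: nP => //; rewrite -[y]mulr1; apply: idealM.
Qed.

End Artinian.
End Nilpotence.

(** * The local rings *)

Section LocalStructure.
Variables (R : comPzRingType) (m : maxideal R).
Local Notation Rm := (locmax m).
Local Notation M_ := (m : ideal R).
Local Notation lm := (locmax_map m).

Lemma locmax_mapV (s : R) (sm : s \notin M_) : lm s * loc_frac 1 (max_den sm) = 1.
Proof. exact: (loc_map_unit (max_den sm)). Qed.

Lemma locmax_nontrivial : lm 1 <> 0.
Proof.
move=> /locmax_map0[s sm]; rewrite mulr1 => s0; case/negP: sm.
by rewrite s0; exact: ideal0.
Qed.

(** Otherwise every nonzero element of [R_m] has a nonzero multiple by an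
    element of [m], and iterating from [1] contradicts T-nilpotence. *)
Lemma t_nilpotent_socle : t_nilpotent m ->
  exists x : R, lm x <> 0 /\ forall a, a \in M_ -> lm (a * x) = 0.
Proof.
move=> tn; apply: contrapT => none.
have ex x : exists a, a \in M_ /\ (lm x <> 0 -> lm (a * x) <> 0).
  have [x0|nx0] := pselect (lm x = 0); first by exists 0; split=> //; exact: ideal0.
  apply: contrapT => H; apply: none; exists x; split=> // a am.
  by apply: contrapT => ax; apply: H; exists a.
have [f fP] := boolp.choice ex.
pose X := fix X n : R := if n is k.+1 then f (X k) * X k else 1.
have X0 n : lm (X n) <> 0.
  elim: n => [|n IHn]; first exact: locmax_nontrivial.
  exact: (fP (X n)).2.
have XE n : X n = \prod_(0 <= i < n) f (X i).
  by elim: n => [|n IHn]; rewrite ?big_nil // big_nat_recr //= -IHn mulrC.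
have [n [s [sm sn]]] := tn (fun n => f (X n)) (fun n => (fP (X n)).1).
by apply: (X0 n); apply/locmax_map0; exists s; rewrite // XE.
Qed.

(** The generators [c j] of [m R_m] generate the annihilator of the socle
    element; each is nilpotent in [R_m] by T-nilpotence of a constant sequence. *)
Lemma local_structure : relations_fg R -> t_nilpotent m ->
  exists p (c : 'I_p -> R) N (x : Rm),
    [/\ forall j, c j \in M_, kills (fun j => lm (c j)) N 1,
        forall y : Rm, inM y -> inJ (fun j => lm (c j)) (y : Rm^o),
        x <> 0 /\ (forall y : Rm, inM y -> y * x = 0) &
        forall a, a \in M_ -> exists s z, s \notin M_ /\ s * a = \sum_j c j * z j].
Proof.
move=> fgR tn; have [x [x0 xm]] := t_nilpotent_socle tn.
have [p [C [xC Cgen]]] := fgR 1%N (fun=> x).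
pose c j := C ord0 j.
have cx j : x * c j = 0 by have := xC j; rewrite big_ord1.
have cm j : c j \in M_.
  apply/negPn/negP => cj; apply: x0; apply/locmax_map0; exists (c j) => //.
  by rewrite mulrC.
have cnil j : exists d, lm (c j) ^+ d = 0.
  have [n [s [sm]]] := tn (fun=> c j) (fun=> cm j).
  rewrite prodr_const_nat subn0 => sn; exists n; rewrite -rmorphXn.
  by apply/locmax_map0; exists s.
have [d dP] := boolp.choice cnil; have [N kN] := kills_nilpotent dP.
have cgen a : a \in M_ -> exists s z, s \notin M_ /\ s * a = \sum_j c j * z j.
  move=> am; have /locmax_map0[t tm tax] := xm a am.
  have [|z zE] := Cgen (fun=> t * a); first by rewrite big_ord1 mulrC -mulrA.
  by exists t, z; split=> //; exact: (zE ord0).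
exists p, c, N, (lm x); split=> // [y [s [a [sm am sy]]]|].
  have [t [z [tm taE]]] := cgen a am.
  have -> : y = (loc_frac 1 (max_den tm) * loc_frac 1 (max_den sm)) * lm (t * a) :> Rm.
    rewrite rmorphM -sy.
    transitivity ((lm t * loc_frac 1 (max_den tm)) *
      (lm s * loc_frac 1 (max_den sm)) * y); last by ring.
    by rewrite !locmax_mapV !mul1r.
  apply: inJZ; rewrite taE rmorph_sum; exists (fun j => lm (z j)).
  by apply: eq_bigr => j _; rewrite rmorphM.
split=> // y [s [a [sm am sy]]].
have sx : lm s * (y * lm x) = 0 by rewrite mulrA sy -rmorphM xm.
by rewrite -[y * _]mul1r -(locmax_mapV sm) mulrAC sx mul0r.
Qed.

Lemma locmax_semiprimary p (c : 'I_p -> Rm) N : kills c N 1 ->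
  (forall y : Rm, inM y -> inJ c (y : Rm^o)) ->
  exists D : semiprimary Rm, forall (V : lmodType Rm) (v : V),
    inJ (@rad_gen Rm D) v <-> inJ c v.
Proof.
move=> kN cM.
have sum1 : \sum_(i < 1) (1 : Rm) * 1 = 1 by rewrite big_ord1 mulr1.
have fld (i : 'I_1) (a : Rm) : inJ c (1 * a : Rm^o) \/
    exists b, inJ c (1 * (1 - b * a) : Rm^o).
  have [[b ab]|/cM aJ] := unit_or_inM a; [right|by left; rewrite mul1r].
  by exists b; rewrite [b * a]mulrC ab subrr mulr0; exact: inJ0.
by exists (Semiprimary kN sum1 fld).
Qed.

(** The ideals generated by the partial products [B n] become stationary, so
    [B n (1 - r a_n) = 0] for some [n] and [r]. *)
Lemma artinian_t_nilpotent : artinian Rm -> t_nilpotent m.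
Proof.
move=> art a am; pose B n := lm (\prod_(0 <= i < n) a i).
have SP n (b : Rm) (x y : Rm^o) : (exists r, x = r * B n) -> (exists r, y = r * B n) ->
    exists r, b *: x + y = r * B n.
  by move=> [r ->] [s ->]; exists (b * r + s); rewrite mulrDl -mulrA.
have S0 n : exists r : Rm, (0 : Rm^o) = r * B n by exists 0; rewrite mul0r.
pose K n : ideal Rm := mksub (S0 n) (SP n).
have KP n y : y \in K n <-> exists r, y = r * B n by exact: (mksubP (S0 n) (SP n)).
have BS n : B n.+1 = B n * lm (a n) by rewrite /B big_nat_recr //= rmorphM.
have [n y /KP[r ->]|n nP] := art K.
  by apply/KP; exists (r * lm (a n)); rewrite BS mulrAC -!mulrA.
have : B n \in K n.+1.
  by rewrite (nP n.+1) //; apply/KP; exists 1; rewrite mul1r.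
move=> /KP[r Br].
have [s sm sB] : exists2 s, s \notin M_ & s * \prod_(0 <= i < n) a i = 0.
  apply/locmax_map0; apply: (@not_inM_cancel _ _ (1 - r * lm (a n))).
    move=> H; have : inM (1 : Rm).
      by rewrite -(subrK (r * lm (a n)) 1); apply: inMD => //; apply/inMl/inM_map.
    exact: (unit_not_inM (mulr1 1)).
  by rewrite -/(B n) mulrBr mulr1 {1}Br BS; ring.
by exists n, s.
Qed.

End LocalStructure.

Theorem envelopes_coherent_locally_artinian (R : comPzRingType) :
  (forall M : lmodType R, has_envelope (@almost_projective R) M) ->
  coherent R /\ locally_artinian R.
Proof.
move=> env; have prodAP (T : Type) : almost_projective (T -> R^o).
  exact: envelopes_products.
have fgR := products_relations_fg prodAP.
split=> [|m]; first exact: relations_fg_coherent.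
have [p [c [N [x [_ kN cM _ _]]]]] :=
  local_structure fgR (@almost_projective_t_nilpotent R m (prodAP nat)).
apply: (local_artinian kN) => y.
by have [[z yz]|/cM] := unit_or_inM y; [left; exists z|right].
Qed.

(** * Rings that are locally fields *)

Section LocallyFields.
Variables (R : comPzRingType) (m : maxideal R).
Local Notation M_ := (m : ideal R).

Lemma maxideal_inv (a : R) : a \notin M_ -> exists b, 1 - b * a \in M_.
Proof.
move=> am; have sub : {subset M_ <= max_add m a}.
  by move=> x xm; apply/asboolP; exists 0; rewrite mul0r subr0.
have [one_notin|/negPn/asboolP[b mb]] := boolP (1 \notin max_add m a); last by exists b.
case/negP: am; rewrite -(maxideal_max sub one_notin).
by apply/asboolP; exists 1; rewrite mul1r subrr; exact: ideal0.
Qed.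

Lemma killed_semisimple (V : lmodType R) :
  (forall a (v : V), a \in M_ -> a *: v = 0) -> semisimple V.
Proof.
move=> mV v; exists 1%N, (fun=> v); split=> [_ a|]; last by rewrite big_ord1.
have [am|/maxideal_inv[b bm]] := boolP (a \in M_); [by left; apply: mV|right].
exists b; rewrite scalerA; apply/eqP; rewrite eq_sym -subr_eq0 -{1}[v]scale1r -scalerBl.
by rewrite mV.
Qed.

Hypothesis m0 : forall a, a \in M_ -> locmax_map m a = 0.

(** Let [N] be the set of elements of [A] that vanish at [m].  The kernel of [g]
    and [A / N] are killed by [m], hence semisimple, and the former embeds into
    the latter; so the kernel is a direct summand of [A]. *)
Lemma field_kernel_lift (M : lmodType R) : kernel_lift m M.
Proof.
move=> A B g f gs gl.
have S0 : exists2 s, s \notin M_ & s *: (0 : A) = 0.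
  by exists 1; rewrite ?scaler0 //; exact: maxideal_proper.
have SP a (x y : A) : (exists2 s, s \notin M_ & s *: x = 0) ->
    (exists2 s, s \notin M_ & s *: y = 0) ->
    exists2 s, s \notin M_ & s *: (a *: x + y) = 0.
  move=> [s sm sx] [t tm ty]; exists (s * t); first exact: max_complM.
  have -> : (s * t) *: (a *: x + y) = (t * a) *: (s *: x) + s *: (t *: y).
    by module_ring.
  by rewrite sx ty !scaler0 addr0.
pose N := mksub S0 SP; pose k := incl (lin_ker g).
have NP x : x \in N <-> exists2 s, s \notin M_ & s *: x = 0 by exact: (mksubP S0 SP).
have [||s sE] := @semisimple_regular _ _ _ (comp_lin (quot_pi N) k).
- apply: killed_semisimple => a v /m0/locmax_map0[s sm sa].
  by apply: (gl s sm).1; rewrite scalerA sa scale0r.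
- apply: killed_semisimple => a v /m0/locmax_map0[s sm sa].
  have [x <-] := quot_pi_surj v; rewrite -linearZ_LR -(linear0 (quot_pi N)).
  by apply/quot_piP; rewrite subr0; apply/NP; exists s; rewrite // scalerA sa scale0r.
have kN x : quot_pi N (k x) = 0 -> x = 0.
  rewrite -(linear0 (quot_pi N)) => /quot_piP; rewrite subr0 => /NP[t tm tx].
  by apply: (gl t tm).1; apply: val_inj.
have sK x : s (quot_pi N (k x)) = x.
  by apply/eqP; rewrite -subr_eq0; apply/eqP/kN; rewrite !linearB [X in X - _]sE subrr.
have [x gx0|h hE] := lin_factor (g := idfun \- (k \o (s \o quot_pi N))) gs.
  have xk : x \in lin_ker g by apply/lin_kerP.
  by rewrite /= [s _](sK (submk xk)) subrr.
exists (comp_lin h f) => x; have [y yE] := gs (f x).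
have kg z : g (k z) = 0 by apply/lin_kerP/valP.
by rewrite -[LHS]/(g (h (f x))) -yE hE /= linearB [X in _ - X]kg subr0.
Qed.

End LocallyFields.

Section ReducedRings.
Variable R : comPzRingType.

Lemma locally_field_envelope :
  (forall (m : maxideal R) a, a \in (m : ideal R) -> locmax_map m a = 0) ->
  forall M : lmodType R, has_envelope (@almost_projective R) M.
Proof.
move=> m0 M; exists M, idfun; split; last by move=> h hE; exists id => x; exact: hE.
split; last by move=> P' h _; exists h.
by apply/almost_projective_lift => m; apply: field_kernel_lift; exact: m0.
Qed.

Lemma reduced_locally_field (m : maxideal R) : reduced R -> t_nilpotent m ->
  forall a, a \in (m : ideal R) -> locmax_map m a = 0.
Proof.
move=> redR tn a am; have [n [s [sm]]] := tn (fun=> a) (fun=> am).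
rewrite prodr_const_nat subn0 => sa; apply/locmax_map0; exists s => //.
case: n sa => [|n] sa; last first.
  apply: (redR _ n.+1); rewrite exprMn_comm; last exact: mulrC.
  by rewrite exprS -mulrA mulrCA sa mulr0.
by case/negP: sm; rewrite -[s]mulr1 -(expr0 a) sa; exact: ideal0.
Qed.

End ReducedRings.

(** * Flat modules and finite weak dimension *)

Section FlatModules.
Variable R : comPzRingType.

(** Let [I] be the ideal of the [a i] and [K] the module of relations, so that
    [I = R^n / K].  Sending [x (x) f], with [x = \sum_i v i * a i], to the class
    of [(v i *: f)_i] defines a map from [I (x) F] to [F^n / K F] which takes
    [\sum_i a i (x) u i] to the class of [u]; this element is [0] because its
    image in [R (x) F] is. *)
Lemma flat_eq_flat (F : lmodType R) : flat F -> eq_flat F.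
Proof.
move=> flatF n a u au; apply/relation_spanP; set K := relation_span F a.
have relK (v : 'I_n -> R) f : \sum_i a i * v i = 0 -> (fun i => v i *: f) \in K.
  move=> av; apply/relation_spanP; exists 1%N, (fun i _ => v i), (fun=> f).
  by split=> [i|j] //; rewrite big_ord1.
pose I := lin_im (mklin (comb_linear (a : 'I_n -> R^o))).
have coordI (x : submod I) : exists v : 'rV[R]_n, \sum_i a i * v 0 i = val x.
  have /lin_imP[v vx] : val x \in I by exact: valP.
  by exists v; rewrite -vx mklinE /comb; apply: eq_bigr => i _; rewrite mulrC.
have [c cE] := boolp.choice coordI.
pose b (x : submod I) (f : F) : quotmod K := quot_pi K (fun i => c x 0 i *: f).
have bE x f (v : 'I_n -> R) : \sum_i a i * v i = val x ->
    quot_pi K (fun i => v i *: f) = b x f.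
  move=> vx; apply/quot_piP.
  have -> : (fun i => v i *: f) - (fun i => c x 0 i *: f) =
      fun i => (v i - c x 0 i) *: f.
    by apply/funext => i; rewrite scalerBl.
  apply: relK; rewrite -[RHS](subrr (val x)) -{1}vx -cE -sumrB.
  by apply: eq_bigr => i _; rewrite mulrBr.
have bDl x x' f : b (x + x') f = b x f + b x' f.
  rewrite -(bE _ _ (fun i => c x 0 i + c x' 0 i)).
    by rewrite -linearD; congr quot_pi; apply/funext => i; rewrite scalerDl.
  rewrite -[RHS]/(val x + val x') -!cE -big_split; apply: eq_bigr => i _.
  by rewrite mulrDr.
have bDr x f f' : b x (f + f') = b x f + b x f'.
  by rewrite -linearD; congr quot_pi; apply/funext => i; rewrite scalerDr.
have bZl r x f : b (r *: x) f = r *: b x f.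
  rewrite -(bE _ _ (fun i => r * c x 0 i)).
    by rewrite -linearZ; congr quot_pi; apply/funext => i; rewrite -scalerA.
  rewrite -[RHS]/(r * val x) -cE mulr_sumr; apply: eq_bigr => i _.
  by rewrite mulrCA.
have bZr r x f : b x (r *: f) = r *: b x f.
  rewrite -linearZ; congr quot_pi; apply/funext => i.
  by rewrite scalerA mulrC -scalerA.
have aI i : a i \in I.
  apply/lin_imP; exists (delta_mx 0 i); rewrite mklinE /comb (bigD1 i) //= mxE !eqxx.
  rewrite scale1r big1 ?addr0 // => j ji.
  by rewrite mxE (negPf ji) andbF scale0r.
pose t := \sum_i tens (submk (aI i)) (u i).
have t0 : t = 0.
  apply: (flatF _ _ (incl I)); first exact: val_inj.
  rewrite linear0 linear_sum.
  transitivity (tens (1 : R^o) (\sum_i a i *: u i)).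
    have tens_sum : linear (tens (1 : R^o) : F -> _).
      by move=> r x y; rewrite tensDr tensZr.
    rewrite -[RHS]/(mklin tens_sum _) linear_sum; apply: eq_bigr => i _.
    rewrite [RHS]tensZr -tensZl; rewrite [LHS]tensor_mapE; congr tens.
    exact: esym (mulr1 _).
  by rewrite au -(scale0r (0 : F)) tensZr scale0r.
have : tensor_lift bDl bDr bZl bZr t = quot_pi K u.
  rewrite linear_sum; apply/eqP; rewrite eq_sym; apply/eqP.
  have uE : u = \sum_i (fun j => (i == j)%:R *: u i).
    apply/funext => j; rewrite fct_sumE (bigD1 j) //= eqxx scale1r big1 ?addr0 // => i.
    by move=> /negPf ->; rewrite scale0r.
  rewrite [LHS](congr1 _ uE) linear_sum; apply: eq_bigr => i _.
  rewrite [RHS]tensor_liftE.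
  apply: bE => /=; rewrite (bigD1 i) //= eqxx mulr1 big1 ?addr0 // => j.
  by rewrite eq_sym => /negPf ->; rewrite mulr0.
by rewrite t0 linear0 -(linear0 (quot_pi K)) => /esym/quot_piP; rewrite subr0.
Qed.

End FlatModules.

Section SocleElement.
Variables (A : comPzRingType) (D : semiprimary A) (x : A).
Local Notation inJ := (inJ (@rad_gen A D)).

(** In a free module, [x u = 0] means that all coordinates of [u] are killed by
    [x]. *)
Lemma projective_socle (P : lmodType A) (u : P) :
  (forall y : A, x * y = 0 -> inJ (y : A^o)) ->
  projective P -> x *: u = 0 -> inJ u.
Proof.
move=> annx Pproj xu0.
have [i iE] := Pproj _ _ _ (idfun : {linear P -> P}) (free_cover_surj (V := P)).
rewrite -[u](iE u); apply: inJ_lin; apply: inJ_free => t; apply: annx.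
have xiu : x *: i u = 0 by rewrite -linearZ_LR xu0 linear0.
have := free_coefP x (i u) 0 t.
by rewrite addr0 xiu -{1}[free_coef 0 t]add0r => /addIr.
Qed.

Lemma inJ_socle (V : lmodType A) (u : V) :
  (forall i, x * @rad_gen A D i = 0) -> inJ u -> x *: u = 0.
Proof.
move=> xJ [w ->]; rewrite scaler_sumr big1 // => i _.
by rewrite scalerA xJ scale0r.
Qed.

End SocleElement.

Section LocalizedFlatness.
Variables (R : comPzRingType) (m : maxideal R).
Local Notation M_ := (m : ideal R).
Local Notation Rm := (locmax m).
Local Notation lm := (locmax_map m).
Local Notation locM M := (locm (max_compl m) M : lmodType Rm).
Local Notation lv := (@locm_map R (max_compl m) _).

Lemma locm_num (M : lmodType R) (y : locM M) :
  exists s x, s \notin M_ /\ lm s *: y = lv x.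
Proof.
elim/locm_fracW: y => x s; exists (sval s), x; split; first exact: (svalP s).
by rewrite locm_frac_scale scalerA loc_map_unit scale1r.
Qed.

Lemma unit_scaleI (V : lmodType Rm) (s : R) (x y : V) :
  s \notin M_ -> lm s *: x = lm s *: y -> x = y.
Proof.
move=> sm E; rewrite -[x]scale1r -[y]scale1r -(locmax_mapV sm) mulrC -!scalerA.
by rewrite E.
Qed.

Lemma eq_flat_locm (F : lmodType R) : eq_flat F -> eq_flat (locM F).
Proof.
move=> Fflat n al y aly.
have [||d dm dP] := common_multiple (m := m) (l := enum 'I_n)
    (Q := fun i s => exists a, lm s * al i = lm a).
- by move=> i s t _ [a sa]; exists (t * a); rewrite !rmorphM -mulrA sa.
- by move=> i _; have [s [a [sm sa]]] := loc_num (al i); exists s => //; exists a.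
have [||e em eP] := common_multiple (m := m) (l := enum 'I_n)
    (Q := fun i s => exists x, lm s *: y i = lv x).
- move=> i s t _ [x sx]; exists (t *: x); rewrite rmorphM -scalerA sx.
  exact: loc_scale_locm_map.
- by move=> i _; have [s [x [sm sx]]] := locm_num (y i); exists s => //; exists x.
have [a aE] := boolp.choice (fun i => dP i (mem_enum _ i)).
have [u uE] := boolp.choice (fun i => eP i (mem_enum _ i)).
have /locm_max0[s sm su] : lv (\sum_i a i *: u i) = 0.
  pose f := mklin (locm_map_linear (max_compl m) (M := F)).
  rewrite -[LHS]/(f _) linear_sum.
  transitivity ((lm d * lm e) *: (\sum_i al i *: y i)); last by rewrite aly scaler0.
  rewrite scaler_sumr; apply: eq_bigr => i _; rewrite linearZ_LR.
  rewrite -[LHS]/(lm (a i) *: (lv (u i) : locM F)) -aE -uE !scalerA.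
  by congr (_ *: _); ring.
have [|p [C [w [uC aC]]]] := Fflat n (fun i => s * a i) u.
  by rewrite -[RHS]su scaler_sumr; apply: eq_bigr => i _; rewrite scalerA.
exists p, (fun i j => lm (C i j)),
  (fun j => loc_frac 1 (max_den em) *: (lv (w j) : locM F)).
split=> [i|j].
  apply: (unit_scaleI em); rewrite uE uC scaler_sumr.
  pose f := mklin (locm_map_linear (max_compl m) (M := F)).
  rewrite -[LHS]/(f _) linear_sum; apply: eq_bigr => j _; rewrite linearZ_LR.
  rewrite -[LHS]/(lm (C i j) *: (lv (w j) : locM F)) !scalerA; congr (_ *: _).
  by rewrite mulrAC locmax_mapV mul1r.
apply: (@unit_scaleI Rm^o (s * d)); first exact: max_complM.
rewrite scaler0 -[LHS]/(lm (s * d) * _) mulr_sumr -[RHS](rmorph0 lm) -(aC j) rmorph_sum.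
by apply: eq_bigr => i _; rewrite !rmorphM -aE; ring.
Qed.

Variables (D : semiprimary Rm) (x : Rm).
Local Notation inJD := (inJ (@rad_gen Rm D)).
Hypotheses (annx : forall y : Rm, x * y = 0 -> inJD (y : Rm^o))
  (xJ : forall i, x * @rad_gen Rm D i = 0).

(** Multiplication by [x] shows that [Z_m -> F_m] stays injective modulo the
    radical; so it splits, and [Z'_m] is a direct summand of [F_m]. *)
Lemma locm_projective_quotient (Z F Z' : lmodType R) (f : {linear Z -> F})
    (g : {linear F -> Z'}) :
  injective f -> surj g -> (forall y, g y = 0 <-> exists z, f z = y) ->
  projective (locM Z) -> projective (locM F) -> projective (locM Z').
Proof.
move=> finj gs exact_fg Zproj Fproj.
have [f' f'E] := locm_functor (max_compl m) f.
have [g' g'E] := locm_functor (max_compl m) g.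
have f'0 z : f' z = 0 -> z = 0.
  elim/locm_fracW: z => z s; rewrite f'E => /locm_frac0[u um].
  rewrite -linearZ_LR => uz; apply/locm_frac0; exists u => //.
  by apply: finj; rewrite uz linear0.
have g's : surj g'.
  by elim/locm_fracW=> z s; have [y <-] := gs z; exists (locm_frac y s).
have [z zJ|rho rhoE] := splitJ (D := D) (f := f') Fproj.
  apply: (projective_socle annx) => //; apply: f'0.
  by rewrite linearZ_LR (inJ_socle xJ).
have g'f' w : g' (f' w) = 0.
  elim/locm_fracW: w => w s; rewrite f'E g'E; apply/locm_frac0.
  exists 1; rewrite ?scale1r; first exact: maxideal_proper.
  by apply/exact_fg; exists w.
have [y gy0|h hE] := lin_factor (g := idfun \- (f' \o rho)) g's.
  suff [z <-] : exists z, f' z = y by rewrite /= rhoE subrr.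
  elim/locm_fracW: y gy0 => y s; rewrite g'E => /locm_frac0[u um].
  rewrite -linearZ_LR => /exact_fg[z zE].
  exists (locm_frac z (loc_den s (max_den um))); rewrite f'E zE.
  by apply: locm_frac_eq; rewrite /= scalerA.
apply: (projective_retract (i := h) (p := g')) => // y.
have [z <-] := g's y; rewrite hE linearB [X in _ - X]g'f'.
by rewrite subr0.
Qed.

(** Descending induction along the resolution, on the images of its
    differentials. *)
Lemma locm_projective_fin_flat_dim (M : lmodType R) n :
  flat_dim_le M n -> projective (locM M).
Proof.
move=> [F Fn].
have Fproj i : projective (locM (F i)).
  apply: (eq_flat_projective D); apply: eq_flat_locm; apply: flat_eq_flat.
  exact: res_termP.
pose Z i := submod (lin_im (res_diff F i)).
have corP i y : res_diff F i y \in lin_im (res_diff F i) by apply/lin_imP; exists y.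
have corL i : linear (fun y => submk (corP i y) : Z i).
  by move=> a u v; apply: val_inj; rewrite /= linearP.
have cor_surj i : surj (mklin (corL i)).
  move=> z; have /lin_imP[y yE] : val z \in lin_im (res_diff F i) by exact: valP.
  by exists y; apply: val_inj.
have Zproj i k : (i + k)%N = n -> projective (locM (Z i)).
  elim: k i => [|k IHk] i ik.
    have Z0 (z : locM (Z i)) : z = 0.
      elim/locm_fracW: z => z s; apply/locm_frac0; exists 1; rewrite ?scale1r.
        exact: maxideal_proper.
      have [y <-] := cor_surj i z.
      by rewrite (Fn _ _ y) ?linear0 // -ik addn0.
    move=> A B g f gs; exists \0 => z.
    by rewrite (Z0 z) !linear0.
  apply: (@locm_projective_quotient (Z i.+1) (F i.+1) (Z i) (incl _)
    (mklin (corL i))) => //.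
  - move=> y; split=> [y0|[z <-]].
      have : res_diff F i y = 0 by move: (congr1 val y0).
      by move=> /res_exact/lin_imP yim; exists (submk yim).
    have /lin_imP/res_exact z0 : val z \in lin_im (res_diff F i.+1) by exact: valP.
    by apply: val_inj; exact: z0.
  - by apply: IHk; rewrite addSnnS.
apply: (@locm_projective_quotient (Z 0%N) (F 0%N) M (incl _) (res_aug F)) => //.
- exact: res_aug_surj.
- move=> y; split=> [/res_exact0/lin_imP yim|[z <-]]; first by exists (submk yim).
  by apply/res_exact0/lin_imP; exact: valP.
- exact: (Zproj 0%N n).
Qed.

End LocalizedFlatness.

(** The class [e] of [1] in the localization of [R/m] is nonzero and killed by
    the radical of [R_m].  If the socle element [x] were in the radical, it would
    kill [e], which by projectivity would be in [m (R/m)_m = 0].  So [x] is a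
    unit; but it is killed by [m R_m]. *)
Lemma fin_weak_gldim_locally_field (R : comPzRingType) (m : maxideal R) :
  relations_fg R -> t_nilpotent m -> fin_weak_gldim R ->
  forall a, a \in (m : ideal R) -> locmax_map m a = 0.
Proof.
move=> fgR tn [n wdim] a am.
have [p [c [N [x [cm kN cM [x0 xM] _]]]]] := local_structure fgR tn.
have [D DP] := locmax_semiprimary kN cM.
have JM (y : locmax m) : inM y <-> inJ (@rad_gen _ D) (y : (locmax m)^o).
  rewrite DP; split=> [/cM//|[w ->]]; elim/big_ind: _; [exact: inM0|exact: inMD|].
  by move=> i _; rewrite -[_ *: _]/(_ * _) mulrC; apply/inMl/inM_map.
have annx y : x * y = 0 -> inJ (@rad_gen _ D) (y : (locmax m)^o).
  move=> xy; apply/JM; apply: contrapT => yM; apply: x0; exact: (not_inM_cancel yM).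
have gen_inJ i : inJ (@rad_gen _ D) (@rad_gen _ D i : (locmax m)^o).
  exists (fun j => (j == i)%:R); rewrite (bigD1 i) //= eqxx big1 ?addr0.
    exact: esym (mulr1 _).
  by move=> j /negPf ->; rewrite scaler0.
have xJ i : x * @rad_gen _ D i = 0 by rewrite mulrC; apply/xM/JM.
pose k := quotmod (m : ideal R).
have kproj : projective (locm (max_compl m) k : lmodType (locmax m)).
  exact: (locm_projective_fin_flat_dim annx xJ (wdim k)).
have km b (z : k) : b \in (m : ideal R) -> b *: z = 0.
  move=> bm; have [y <-] := quot_pi_surj z.
  rewrite -linearZ_LR -(linear0 (quot_pi _)); apply/quot_piP; rewrite subr0.
  by rewrite -[_ *: _]/(b * y) mulrC; exact: idealM.
pose K : lmodType (locmax m) := locm (max_compl m) k.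
pose e : K := locm_map (max_compl m) (quot_pi _ (1 : R^o)).
have lv0 : locm_map (max_compl m) 0 = 0 :> K.
  by apply/locm_max0; exists 1; rewrite ?scaler0 //; exact: maxideal_proper.
have e0 : e <> 0.
  move=> /locm_max0[s sm]; rewrite -linearZ_LR -(linear0 (quot_pi _)).
  by move=> /quot_piP; rewrite subr0 -[_ *: _]/(s * 1) mulr1; apply/negP.
have xNM : ~ inM x.
  move=> xinM; apply: e0; have : x *: e = 0.
    have [s [b [sm bm sx]]] := xinM.
    apply: (@unit_scaleI _ _ K _ _ _ sm); rewrite scalerA sx scaler0.
    by rewrite /e loc_scale_locm_map km.
  move=> /(projective_socle annx kproj)/DP[w ->]; rewrite big1 // => j _.
  elim/locm_fracW: (w j) => z s; rewrite locm_frac_scale scalerA mulrC -scalerA.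
  by rewrite loc_scale_locm_map km // lv0 scaler0.
by apply: (not_inM_cancel xNM); apply: xM; apply/inM_map.
Qed.

(** * Isolated maximal ideals *)

Section IsolatedPoints.
Variable R : comPzRingType.

(** A witness that [m] is an isolated point of the spectrum: when [m R_m] is
    nil, [R_m] is the ring of fractions of [R] by the powers of [e]. *)
Definition isolates (m : maxideal R) (e : R) : Prop :=
  e \notin (m : ideal R) /\ forall a, locmax_map m a = 0 -> e * a = 0.

Lemma isolates_nil (m : maxideal R) e a : isolates m e -> t_nilpotent m ->
  a \in (m : ideal R) -> exists n, e * a ^+ n = 0.
Proof.
move=> [_ e0] tn am; have [n [s [sm]]] := tn (fun=> a) (fun=> am).
rewrite prodr_const_nat subn0 => sa; exists n; apply: e0.
by apply/locmax_map0; exists s.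
Qed.

(** [1 - b s] is in [m] for some [b], hence nilpotent up to multiplication by
    [e]; take for [t] the truncated geometric series times [b]. *)
Lemma isolates_inv (m : maxideal R) e s : isolates m e -> t_nilpotent m ->
  s \notin (m : ideal R) -> exists t, e * (1 - t * s) = 0.
Proof.
move=> em tn /maxideal_inv[b bm]; have [n en] := isolates_nil em tn bm.
exists (b * \sum_(i < n) (1 - b * s) ^+ i).
rewrite -[RHS]en; congr (e * _); apply/eqP; rewrite -subr_eq0.
have := subrX1 (1 - b * s) n; set S := \sum_(i < n) _ => E.
apply/eqP; rewrite -[X in _ - X](subrK 1) E; ring.
Qed.

(** Dividing [A] by the part of the kernel that [e] annihilates leaves a kernel
    isomorphic to [e (ker g)], on which elements outside [m] act bijectively;
    multiplication by [e] leads back to [A]. *)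
Lemma isolated_lift (m : maxideal R) e (P : lmodType R) :
  isolates m e -> t_nilpotent m -> almost_projective P ->
  forall (A B : lmodType R) (g : {linear A -> B}) (f : {linear P -> B}), surj g ->
  exists h : {linear P -> A}, forall x, g (h x) = e *: f x.
Proof.
move=> em tn /almost_projective_lift/(_ m) lift A B g f gs.
have S0 : e *: (0 : A) = 0 /\ g 0 = 0 by rewrite scaler0 linear0.
have SP a (x y : A) : e *: x = 0 /\ g x = 0 -> e *: y = 0 /\ g y = 0 ->
    e *: (a *: x + y) = 0 /\ g (a *: x + y) = 0.
  move=> [ex gx] [ey gy]; rewrite linearP gx gy scaler0 addr0; split=> //.
  by rewrite scalerDr scalerA mulrC -scalerA ex ey scaler0 addr0.
pose T := mksub S0 SP.
have TP x : x \in T <-> e *: x = 0 /\ g x = 0 by exact: (mksubP S0 SP).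
have piT x : quot_pi T x = 0 <-> e *: x = 0 /\ g x = 0.
  by rewrite -TP -(linear0 (quot_pi T)); split=> [/quot_piP|H];
    [rewrite subr0|apply/quot_piP; rewrite subr0].
have [x /piT[_ //]|g0 g0E] := lin_factor (g := g) (@quot_pi_surj _ _ T).
have [x /piT[ex _]|E EE] := lin_factor (g := *:%R e : {linear A -> A})
  (@quot_pi_surj _ _ T).
  exact: ex.
have g0s : surj g0.
  by move=> z; have [y <-] := gs z; exists (quot_pi T y); exact: g0E.
have [|h hE] := lift _ _ g0 f g0s; last first.
  exists (comp_lin E h) => x; have [y yE] := quot_pi_surj (h x).
  by rewrite /= -hE -yE EE g0E /= linearZ_LR.
move=> s sm; have [t et] := isolates_inv em tn sm.
have ets (y : A) : e *: y = (e * t) *: (s *: y).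
  apply/eqP; rewrite -subr_eq0 scalerA -scalerBl -[e in e - _]mulr1 -mulrA -mulrBr et.
  by rewrite scale0r.
split=> [[x xk] /(congr1 val)|[x xk]] /=.
  have [y yE] := quot_pi_surj x; subst x.
  rewrite -linearZ_LR => /piT[esy gsy]; apply: val_inj; apply/piT.
  have gy : g y = 0 by rewrite -g0E; apply/lin_kerP.
  by split=> //; rewrite ets scalerA mulrAC mulrC -scalerA -scalerA esy !scaler0.
have [y yE] := quot_pi_surj x; subst x.
have gy : g y = 0 by rewrite -g0E; apply/lin_kerP.
have tk : quot_pi T (t *: y) \in lin_ker g0.
  by apply/lin_kerP; rewrite g0E linearZ_LR gy scaler0.
exists (submk tk); apply: val_inj; rewrite -[LHS]/(s *: quot_pi T (t *: y)) -linearZ_LR.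
apply/eqP; rewrite -subr_eq0 -[val _]/(quot_pi T y) -linearB; apply/eqP/piT.
split; last by rewrite (linearB g) !(linearZ_LR g) gy !scaler0 subr0.
rewrite scalerBr [e *: y]ets !scalerA -scalerBl (_ : _ - _ = 0) ?scale0r //.
ring.
Qed.

Hypotheses (fgR : relations_fg R) (tn : forall m : maxideal R, t_nilpotent m)
  (iso : forall m : maxideal R, exists e, isolates m e).

(** The ideal generated by the isolating elements is in no maximal ideal. *)
Lemma isolated_cover : exists n (r e : 'I_n -> R) (m : 'I_n -> maxideal R),
  (forall i, isolates (m i) (e i)) /\ \sum_i r i * e i = 1.
Proof.
pose X := {me : maxideal R * R | isolates me.1 me.2}.
pose S (x : R^o) := exists n (r : 'I_n -> R) (p : 'I_n -> X),
  x = \sum_i r i * (sval (p i)).2.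
have S0 : S 0.
  exists 0%N, (fun=> 0), (fun i : 'I_0 => False_rect X (notF (ltn_ord i))).
  by rewrite big_ord0.
have SP (a : R) (x y : R^o) : S x -> S y -> S (a *: x + y).
  move=> [n [r [p ->]]] [k [t [q ->]]]; exists (n + k)%N,
    (fun i => match fintype.split i with inl j => a * r j | inr j => t j end),
    (fun i => match fintype.split i with inl j => p j | inr j => q j end).
  rewrite big_split_ord /=; congr (_ + _); last first.
    by apply: eq_bigr => i _; rewrite (unsplitK (inr i)).
  by rewrite scaler_sumr; apply: eq_bigr => i _; rewrite (unsplitK (inl i)) -mulrA.
pose J : ideal R := mksub S0 SP.
have JP x : x \in J <-> S x by exact: (mksubP S0 SP).
have /negPn/JP[n [r [p rp1]]] : ~~ (1 \notin J).
  apply/negP => /exists_maxideal[m Jm]; have [e em] := iso m.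
  case/negP: (em.1); apply/Jm/JP.
  by exists 1%N, (fun=> 1), (fun=> exist _ (m, e) em : X); rewrite big_ord1 mul1r.
exists n, r, (fun i => (sval (p i)).2), (fun i => (sval (p i)).1).
by split=> [i|]; [exact: (svalP (p i))|rewrite [RHS]rp1].
Qed.

(** The radical is generated by the products [e i * c j], for [c j] generating
    [m_i R_(m_i)]. *)
Lemma isolated_semiprimary : inhabited (semiprimary R).
Proof.
have [n [r [e [m [em re1]]]]] := isolated_cover.
have loc i : exists pc : {p : nat & 'I_p -> R},
    (forall j, projT2 pc j \in (m i : ideal R)) /\
    forall a, a \in (m i : ideal R) -> exists s z, s \notin (m i : ideal R) /\
      s * a = \sum_j projT2 pc j * z j.
  have [p [c [N [x [cm _ _ _ cgen]]]]] := local_structure fgR (@tn (m i)).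
  by exists (existT _ p c).
have [pc pcP] := boolp.choice loc.
pose I := {i : 'I_n & 'I_(projT1 (pc i))}.
pose c (k : I) : R := e (tag k) * projT2 (pc (tag k)) (tagged k).
have cnil k : exists d, c k ^+ d = 0.
  have [d ed] := isolates_nil (em (tag k)) (@tn _) ((pcP (tag k)).1 (tagged k)).
  exists d.+1; rewrite exprMn_comm; last exact: mulrC.
  move: ed; set u := e _; set v := projT2 (pc _) _ => uv.
  transitivity (u ^+ d * v * (u * v ^+ d)); last by rewrite uv mulr0.
  by rewrite !exprS; ring.
have [d dP] := boolp.choice cnil; have [N kN] := kills_nilpotent dP.
have fld (i : 'I_n) a : inJ c (e i * a : R^o) \/
    exists b, inJ c (e i * (1 - b * a) : R^o).
  have [am|am] := boolP (a \in (m i : ideal R)); [left|right]; last first.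
    by have [t et] := isolates_inv (em i) (@tn _) am; exists t; rewrite et; exact: inJ0.
  have [s [z [sm sa]]] := (pcP i).2 a am.
  have [t et] := isolates_inv (em i) (@tn _) sm.
  have -> : e i * a = t *: (e i * (s * a) : R^o).
    by rewrite -[a in LHS]mul1r -(subrK (t * s) 1) mulrDl mulrDr mulrA et mul0r add0r
      -[RHS]/(t * _); ring.
  apply: inJZ; rewrite sa mulr_sumr; elim/big_ind: _ => [|u v|j _].
  - exact: inJ0.
  - exact: inJD.
  pose ij : I := existT (fun i => 'I_(projT1 (pc i))) i j.
  have -> : e i * (projT2 (pc i) j * z j) = z j *: (c ij : R^o) by rewrite mulrA mulrC.
  apply: inJZ; exists (fun k => (k == ij)%:R).
  rewrite (bigD1 ij) //= eqxx big1 ?addr0; first exact: esym (mulr1 _).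
  by move=> k /negPf ->; rewrite scaler0.
exact: (inhabits (Semiprimary kN re1 fld)).
Qed.

Lemma isolated_projective (P : lmodType R) : almost_projective P -> projective P.
Proof.
move=> PAP A B g f gs; have [n [r [e [m [em re1]]]]] := isolated_cover.
have [h hE] := boolp.choice (fun i => isolated_lift (em i) (@tn (m i)) PAP f gs).
have hL : linear (fun x => \sum_i r i *: h i x).
  move=> a x y; rewrite scaler_sumr -big_split; apply: eq_bigr => i _ /=.
  by rewrite linearP scalerDr !scalerA mulrC.
exists (mklin hL) => x; rewrite mklinE linear_sum -[RHS]scale1r -re1 scaler_suml.
by apply: eq_bigr => i _; rewrite linearZ_LR hE scalerA.
Qed.

Lemma isolated_envelope (M : lmodType R) : has_envelope (@almost_projective R) M.
Proof.
have [D] := isolated_semiprimary.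
have [P [f [[Pproj fP] fmin]]] := projective_envelope D fgR M.
exists P, f; split=> //; split; first exact: projective_almost_projective.
by move=> P' h /isolated_projective; apply: fP.
Qed.

End IsolatedPoints.

Section IsolatingElements.
Variables (R : comPzRingType) (m : maxideal R).
Local Notation M_ := (m : ideal R).

(** If no element outside [m] isolates [m], then starting from [1] one can keep
    multiplying by elements outside [m] so that the annihilators increase
    strictly. *)
Lemma noetherian_isolates : noetherian R -> exists e, isolates m e.
Proof.
move=> noeth; apply: contrapT => none.
have ex e : exists s, s \notin M_ /\ (e \notin M_ -> exists a, s * a = 0 /\ e * a <> 0).
  have [em|em] := boolP (e \in M_).
    by exists 1; split=> //; exact: maxideal_proper.
  apply: contrapT => H; apply: none; exists e; split=> // a /locmax_map0[s sm sa].
  by apply: contrapT => ea; apply: H; exists s; split=> // _; exists a.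
have [sg sgP] := boolp.choice ex.
pose e := fix e n : R := if n is k.+1 then sg (e k) * e k else 1.
have em n : e n \notin M_.
  elim: n => [|n IHn]; first exact: maxideal_proper.
  exact: max_complM (sgP _).1 IHn.
have S0 n : e n * (0 : R^o) = 0 by rewrite mulr0.
have SP n (a : R) (x y : R^o) : e n * x = 0 -> e n * y = 0 -> e n * (a *: x + y) = 0.
  by move=> ex0 ey0; rewrite mulrDr ey0 addr0 -[a *: x]/(a * x) mulrCA ex0 mulr0.
pose K n : ideal R := mksub (S0 n) (SP n).
have KP n x : x \in K n <-> e n * x = 0 by exact: (mksubP (S0 n) (SP n)).
have [n x /KP ex0|n nP] := noeth K; first by apply/KP; rewrite /= -mulrA ex0 mulr0.
have [a [sa ea]] := (sgP (e n)).2 (em n).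
by apply/ea/KP; rewrite -(nP n.+1) //; apply/KP; rewrite /= mulrAC sa mul0r.
Qed.

(** A common denominator of finitely many generators is invertible in the image
    of [R], so [R -> R_m] is surjective; a section of it takes [1] to an
    isolating element. *)
Lemma fin_projective_isolates :
  fin_generated (restr (locmax_map m) (locmax m)^o) ->
  projective (restr (locmax_map m) (locmax m)^o) -> exists e, isolates m e.
Proof.
move=> [n [p ps]] proj; pose N := restr (locmax_map m) (locmax m)^o.
pose y i : locmax m := p (delta_mx 0 i).
have pE (v : 'rV[R]_n) : p v = \sum_i locmax_map m (v 0 i) * y i :> locmax m.
  exact: (rV_comb p v).
have [||d dm dP] := common_multiple (m := m) (l := enum 'I_n)
    (Q := fun i s => exists a, locmax_map m s * y i = locmax_map m a).
- by move=> i s t _ [a sa]; exists (t * a); rewrite !rmorphM -mulrA sa.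
- by move=> i _; have [s [a [sm sa]]] := loc_num (y i); exists s => //; exists a.
have [a aE] := boolp.choice (fun i => dP i (mem_enum _ i)).
have surjd z : exists b, locmax_map m d * z = locmax_map m b.
  have [v vE] := ps z; exists (\sum_i v 0 i * a i); rewrite -vE pE mulr_sumr rmorph_sum.
  by apply: eq_bigr => i _; rewrite mulrCA aE rmorphM.
have lm_surj z : exists b, locmax_map m b = z.
  have [b bE] := surjd (loc_frac 1 (max_den dm) * z).
  by exists b; rewrite -bE mulrA locmax_mapV mul1r.
have lmL : linear (locmax_map m : R^o -> N).
  by move=> b u v; rewrite rmorphD; congr (_ + _); exact: rmorphM.
have [h hE] := proj R^o N (mklin lmL) idfun lm_surj.
exists (h (1 : locmax m)); split=> [|b b0].
  apply/negP => /(inM_map m); rewrite -[locmax_map m _]/(mklin lmL _) hE.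
  exact: (unit_not_inM (mulr1 1)).
rewrite mulrC -[LHS]/(b *: h _) -linearZ_LR.
have -> : b *: (1 : N) = 0 by rewrite -[LHS]/(locmax_map m b * 1) b0 mul0r.
by rewrite linear0.
Qed.

End IsolatingElements.

Theorem theorem4 (R : comPzRingType) :
  ((forall M : lmodType R, has_envelope (@almost_projective R) M) ->
     coherent R /\ locally_artinian R)
  /\
  (reduced R \/ fin_weak_gldim R \/ noetherian R \/
     (forall m : maxideal R,
        fin_generated (restr (locmax_map m) (locmax m)^o) /\
        projective (restr (locmax_map m) (locmax m)^o)) ->
   coherent R /\ locally_artinian R ->
   forall M : lmodType R, has_envelope (@almost_projective R) M).
Proof.
split; first exact: envelopes_coherent_locally_artinian.
move=> cases [cohR artR] M.
have fgR := coherent_relations_fg cohR.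
have tn (m : maxideal R) : t_nilpotent m by exact: artinian_t_nilpotent.
case: cases => [redR|[wdim|[noethR|fpR]]].
- by apply: locally_field_envelope => m; apply: reduced_locally_field.
- by apply: locally_field_envelope => m; apply: fin_weak_gldim_locally_field.
- by apply: isolated_envelope => // m; apply: noetherian_isolates.
apply: isolated_envelope => // m; have [fg proj] := fpR m.
exact: fin_projective_isolates.
Qed.
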